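(* Let $d\ge 2$. Then, for $p>p^{\rm p}_{\rm c}(d)$, with $$p^{\rm p}_{\rm c}(d)=\sqrt{\frac{2d^2+2d-4}{2d^2+2d-3}},$$ the first-layer constraint model $\gamma^S$ with density parameter $p$ admits a unique infinite-volume Gibbs measure, for all unfixed areas $S\subset\mathbb Z^d$.
   Context: Let $p\in[0,1]$ be the density parameter, and write $i\sim j$ for the usual nearest-neighbor relation on $\mathbb Z^d$. For $\Delta\subset\mathbb Z^d$ write $\Delta^c=\mathbb Z^d\setminus\Delta$ and let $\bar\Delta=\Delta\cup\{j\in\mathbb Z^d: j\sim i\text{ for some }i\in\Delta\}$ be its extension. Let $S\subset\mathbb Z^d$ be a set of sites, called the unfixed area (or unfixed region). For finite $\Delta\subset\mathbb Z^d$ let $$\mu_p(\omega_{\Delta\cap S})=\prod_{i\in\Delta\cap S}p^{\omega_i}(1-p)^{1-\omega_i}$$ be the i.i.d. Bernoulli weight of a configuration $\omega_{\Delta\cap S}\in\{0,1\}^{\Delta\cap S}$. A site $i$ is occupied if $\omega_i=1$. A configuration on $S$ is called $T$-feasible on $\Delta\cap S$ if every occupied site in $\Delta\cap S$ has at least one occupied neighbor, which may lie in $\bar\Delta\cap S$. The first-layer constraint model on $\{0,1\}^S$ is given by the kernels $\gamma^S=(\gamma^S_\Delta)_\Delta$, indexed by finite $\Delta\subset\mathbb Z^d$, $$\gamma^S_\Delta(\omega_\Delta\,|\,\omega_{\Delta^c})=\frac{\mu_p(\omega_{\Delta\cap S})\,\mathbf 1\{\omega_{\Delta\cap S}\,\omega_{\Delta^c\cap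 S}\text{ is }T\text{-feasible on }\Delta\cap S\}}{\sum_{\tilde\omega_{\Delta\cap S}\in\{0,1\}^{\Delta\cap S}}\mu_p(\tilde\omega_{\Delta\cap S})\,\mathbf 1\{\tilde\omega_{\Delta\cap S}\,\omega_{\Delta^c\cap S}\text{ is }T\text{-feasible on }\Delta\cap S\}},$$ where $\omega_{\Delta\cap S}\,\omega_{\Delta^c\cap S}$ denotes the configuration on $S$ obtained by concatenation; only the sites in $S$ enter. An infinite-volume Gibbs measure for $\gamma^S$ is a probability measure $\mu$ on $\{0,1\}^S$ satisfying the DLR equations: for all finite $\Delta\subset\mathbb Z^d$ and all local configurations $\omega_\Delta$ (on $\Delta\cap S$), $\int\mu(\mathrm d\tilde\omega)\,\gamma^S_\Delta(\omega_\Delta\,|\,\tilde\omega_{\Delta^c})=\mu(\omega_\Delta)$.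
   Formalization: The kernel requires T-feasibility on the extension of Δ intersected with S, not only on Δ∩S (the literal kernels are inconsistent for two adjacent sites, so no Gibbs measure exists), and p<1 is assumed, since at p=1 the kernel's denominator vanishes. *)

(* Defs.v *)
From HB Require Import structures.
From mathcomp Require Import all_boot all_order all_algebra finmap.
From mathcomp Require Import all_classical all_reals all_analysis.

Set Implicit Arguments.
Unset Strict Implicit.
Unset Printing Implicit Defensive.

Import Order.TTheory GRing.Theory Num.Theory.

Local Open Scope classical_set_scope.
Local Open Scope ring_scope.

Definition site (d : nat) : Type := {ffun 'I_d -> int}.
HB.instance Definition _ (d : nat) := Choice.on (site d).

(* Nearest neighbours: l1-distance one. *)
Definition adj (d : nat) (i j : site d) : Prop :=
  \sum_(k < d) `|i k - j k| = 1.

Definition extension (d : nat) (D : set (site d)) : set (site d) :=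
  D `|` [set j | exists2 i, D i & adj j i].

(* {0,1}^S, where S is coerced to the type of its elements. *)
Definition config (d : nat) (S : set (site d)) : Type := S -> bool.
HB.instance Definition _ (d : nat) (S : set (site d)) :=
  Pointed.on (config S).

(* The events {omega_i = b}; they generate the product sigma-algebra. *)
Definition coordinate_events (d : nat) (S : set (site d)) :
    set (set (config S)) :=
  [set A | exists (i : S) (b : bool), A = [set w | w i = b]].

Arguments coordinate_events {d} S.

(* {0,1}^S as a measurable space. *)
Definition config_space (d : nat) (S : set (site d)) :=
  g_sigma_algebraType (coordinate_events S).

(* Delta `&` S as a finite set. *)
Definition inside (d : nat) (S : set (site d)) (D : {fset site d}) :
    {fset site d} :=
  [fset i in D | i \in S]%fset.

Definition local_config (d : nat) (S : set (site d)) (D : {fset site d}) :=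
  {ffun inside S D -> bool}.

(* The configuration equal to eta on Delta `&` S and to w on S `\` Delta. *)
Definition concat (d : nat) (S : set (site d)) (D : {fset site d})
    (eta : local_config S D) (w : config S) : config S :=
  fun i => if insub (val i) is Some k then eta k else w i.

Definition cylinder (d : nat) (S : set (site d)) (D : {fset site d})
    (eta : local_config S D) : set (config_space S) :=
  [set w | forall (i : S) (k : inside S D), val i = val k -> w i = eta k].

Definition T_feasible (d : nat) (S : set (site d)) (L : set (site d))
    (w : config S) : Prop :=
  forall i : S, L (val i) -> w i ->
    exists2 j : S, adj (val j) (val i) & w j.

Definition bernoulli_weight (R : realType) (d : nat) (p : R)
    (S : set (site d)) (D : {fset site d}) (eta : local_config S D) : R :=
  \prod_(k : inside S D) (p ^+ eta k * (1 - p) ^+ (1 - eta k)).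

(* The constraint is imposed at the sites of S in the extension of Delta,
   i.e. at all sites whose constraint can depend on the spins in Delta.
   Imposing it at the sites of Delta alone would give kernels that are not
   consistent: for S = {i, j} with i ~ j, the kernel with Delta = S forces
   the law P(11) : P(00) = p^2 : (1 - p)^2, P(10) = P(01) = 0, whereas the one
   with Delta = {i} would require P(omega_i = 1) = p * P(omega_j = 1). *)
Definition constrained_weight (R : realType) (d : nat) (p : R)
    (S : set (site d)) (D : {fset site d}) (eta : local_config S D)
    (w : config S) : R :=
  bernoulli_weight p eta *
  (`[< T_feasible (extension [set` D]) (concat eta w) >])%:R.

(* gamma^S_Delta(eta | w); it depends on w only through S `\` Delta.
   With the convention x / 0 = 0 it vanishes for every eta when w admits no
   feasible eta; summing the DLR equations over eta shows that a Gibbs measure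
   gives probability zero to such w. At p = 1 it can vanish for every w (take
   S a singleton meeting Delta), so the model is only considered for p < 1. *)
Definition first_layer_kernel (R : realType) (d : nat) (p : R)
    (S : set (site d)) (D : {fset site d}) (eta : local_config S D)
    (w : config S) : R :=
  constrained_weight p eta w /
  \sum_(zeta : local_config S D) constrained_weight p zeta w.

Definition is_gibbs (R : realType) (d : nat) (p : R) (S : set (site d))
    (mu : probability (config_space S) R) : Prop :=
  forall (D : {fset site d}) (eta : local_config S D),
    (\int[mu]_w (first_layer_kernel p eta w)%:E = mu (cylinder eta))%E.

(* Measures are compared on measurable sets, the only sets on which a
   probability is determined. *)
Definition unique_gibbs (R : realType) (d : nat) (p : R)
    (S : set (site d)) : Prop :=
  exists2 mu : probability (config_space S) R, is_gibbs p mu &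
    forall nu : probability (config_space S) R, is_gibbs p nu ->
      forall A : set (config_space S), measurable A -> nu A = mu A.

Definition p_c (R : realType) (d : nat) : R :=
  Num.sqrt ((2 * d%:R ^+ 2 + 2 * d%:R - 4) / (2 * d%:R ^+ 2 + 2 * d%:R - 3)).

(* Main.v *)
From HB Require Import structures.
Require Import Defs.
From mathcomp Require Import all_boot all_order all_algebra finmap.
From mathcomp Require Import all_classical all_reals all_analysis.
From mathcomp Require Import measurable_realfun zify ring lra.

Set Implicit Arguments.
Unset Strict Implicit.
Unset Printing Implicit Defensive.

Import Order.TTheory GRing.Theory Num.Theory.
Import numFieldNormedType.Exports.

Local Open Scope fset_scope.
Local Open Scope classical_set_scope.
Local Open Scope ring_scope.

(** Write q = 1 - p.  Uniqueness comes from a comparison of two independent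
    copies of the model in the same finite volume, with two boundary
    conditions.  Two sites interact when they lie in one star, i.e. when they
    are at distance at most two, and a site has n = 2 d + 2 d ^ 2 such partners.
    If the cluster of disagreements met by the support of an observable f stays
    away from the boundary, exchanging the copies on that cluster preserves
    feasibility in both copies, because each star contains all or none of its
    disagreements in the cluster, and it exchanges the two values of f
    (swap_feas, swap_observable).  Hence the expectations of f under the two
    boundary conditions differ at most by the probability that disagreements
    join the support of f to the boundary (compare_boundaries).

    A disagreement needs an empty site in one of the copies, and emptiness is
    costly in spite of the hard constraint: two adjacent sites can always be
    filled together, which shows that a list U of sites with neighbors in the
    volume is empty with probability at most rho ^+ size U, for a rate rho
    slightly larger than q (zeros_bound).  So a given path of k sites consists
    of disagreements with probability at most (2 * rho) ^+ k (path_bound).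
    Exploring the cluster in layers produces paths whose steps avoid the
    surroundings of the last but one site (layer_path); on the lattice this
    leaves at most n - 4 choices per step (near0_step).  The threshold is
    equivalent to (1 - p ^+ 2) * (n - 3) < 1, which implies
    2 * rho * (n - 4) < 1 (empty_rate_spec): the influence of the boundary
    decays exponentially (boundary_influence).

    Through the DLR equations this determines the probability of every local
    event under a Gibbs measure, as the limit of the finite-volume averages
    with empty boundary (gibbs_near), whence uniqueness.  The same estimate and
    the consistency of the kernels make these averages a Cauchy sequence
    (cvg_state).  Their limit is additive on the algebra of local events, where
    compactness of the configuration space makes it sigma-additive; its
    extension satisfies the DLR equations because the kernels are local
    (extended_measure_gibbs). *)

(** * Iterated averages *)

Section Averaging.
Variables (R : realType) (T : eqType) (K : finType) (m : K -> R).
Implicit Types (w : T -> K) (s t : seq T) (f g : (T -> K) -> R).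

Definition upd w x a : T -> K := fun y => if y == x then a else w y.

Definition agree_off (D : seq T) w w' := forall x, x \notin D -> w x = w' x.

(** Sums over the configurations in a finite volume, written as iterated
    single-site sums: volumes are lists, which can be split and reordered
    without changing the type of the configurations.  The spins K are bool for
    one copy of the model and bool * bool for two. *)
Fixpoint avg s f w : R :=
  if s is x :: s' then \sum_a m a * avg s' f (upd w x a) else f w.

Lemma updC w x y a b : x != y -> upd (upd w x a) y b = upd (upd w y b) x a.
Proof.
move=> xy; apply: funext => z; rewrite /upd.
by have [->|//] := eqVneq z y; rewrite eq_sym (negbTE xy).
Qed.

Lemma avg_cat s t f w : avg (s ++ t) f w = avg s (avg t f) w.
Proof.
by elim: s w => //= x s IH w; apply: eq_bigr => a _; rewrite IH.
Qed.

Lemma eq_avg s f g w :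
  (forall w', agree_off s w' w -> f w' = g w') -> avg s f w = avg s g w.
Proof.
elim: s w => [|x s IH] w fg /=; first by apply: fg.
apply: eq_bigr => a _; congr (_ * _); apply: IH => w' w'w.
apply: fg => y; rewrite inE negb_or => /andP[yx ys].
by rewrite w'w// /upd (negbTE yx).
Qed.

Lemma le_avg s f g w : (forall a, 0 <= m a) ->
  (forall w', agree_off s w' w -> f w' <= g w') -> avg s f w <= avg s g w.
Proof.
move=> m0; elim: s w => [|x s IH] w fg /=; first by apply: fg.
apply: ler_sum => a _; rewrite ler_wpM2l//; apply: IH => w' w'w.
apply: fg => y; rewrite inE negb_or => /andP[yx ys].
by rewrite w'w// /upd (negbTE yx).
Qed.

Lemma avgZ s c f w : avg s (fun v => c * f v) w = c * avg s f w.
Proof.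
elim: s w => //= x s IH w; rewrite mulr_sumr; apply: eq_bigr => a _.
by rewrite IH mulrCA.
Qed.

Lemma avg_sum (I : Type) (r : seq I) (P : pred I) s (f : I -> _ -> R) w :
  avg s (fun v => \sum_(i <- r | P i) f i v) w =
  \sum_(i <- r | P i) avg s (f i) w.
Proof.
elim: s w => //= x s IH w; under eq_bigr do rewrite IH mulr_sumr.
by rewrite exchange_big.
Qed.

Lemma avgD s f g w :
  avg s (fun v => f v + g v) w = avg s f w + avg s g w.
Proof.
elim: s w => //= x s IH w; under eq_bigr do rewrite IH mulrDr.
by rewrite big_split.
Qed.

Lemma avgN s f w : avg s (fun v => - f v) w = - avg s f w.
Proof.
by rewrite -mulN1r -avgZ; apply: eq_avg => v _; rewrite mulN1r.
Qed.

Lemma avg_ge0 s f w : (forall a, 0 <= m a) -> (forall v, 0 <= f v) ->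
  0 <= avg s f w.
Proof.
move=> m0 f0; elim: s w => //= x s IH w.
by apply: sumr_ge0 => a _; rewrite mulr_ge0.
Qed.

Lemma avg_agree s f w w' : agree_off s w w' -> avg s f w = avg s f w'.
Proof.
elim: s w w' => [|x s IH] w w' ww' /=.
  by congr f; apply: funext => y; apply: ww'.
apply: eq_bigr => a _; congr (_ * _); apply: IH => y ys.
by rewrite /upd; case: (eqVneq y x) => // yx; apply: ww'; rewrite inE negb_or yx.
Qed.

Lemma avg_pull s f g w : (forall v v', agree_off s v v' -> g v = g v') ->
  avg s (fun v => g v * f v) w = g w * avg s f w.
Proof.
move=> gs; rewrite -avgZ; apply: eq_avg => v vw; congr (_ * _); exact: gs.
Qed.

Lemma avg_swap2 x y s f w : avg [:: x, y & s] f w = avg [:: y, x & s] f w.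
Proof.
have [->//|xy] := eqVneq x y; rewrite /=.
under eq_bigr do rewrite mulr_sumr.
rewrite exchange_big; apply: eq_bigr => b _ /=; rewrite mulr_sumr.
by apply: eq_bigr => a _; rewrite mulrCA updC.
Qed.

(** Single-site sums commute. *)
Lemma avg_perm s t f w : perm_eq s t -> avg s f w = avg t f w.
Proof.
have front x u v f' w' : avg (u ++ x :: v) f' w' = avg (x :: u ++ v) f' w'.
  elim: u w' => // y u IH w'; rewrite cat_cons -[RHS]avg_swap2 /=.
  by apply: eq_bigr => a _; rewrite IH.
elim: s t w => [|x s IH] t w.
  by rewrite perm_sym => /perm_nilP ->.
move=> pst; have xt : x \in t by rewrite -(perm_mem pst) mem_head.
have [u [v tE]] : exists u v, t = u ++ x :: v by case/splitPr: xt => u v; exists u, v.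
rewrite tE front /=; apply: eq_bigr => a _; rewrite (IH (u ++ v))//.
rewrite -(perm_cons x); apply: perm_trans pst _.
by rewrite tE -[x :: v]cat1s perm_catCA.
Qed.

End Averaging.

Arguments eq_avg {R T K m s f g w}.
Arguments avg_agree {R T K m s f w w'}.

(** * Empty sites are costly *)

Definition bweight (R : realType) (p : R) (b : bool) : R :=
  p ^+ b * (1 - p) ^+ (1 - b).

Lemma bweight_ge0 (R : realType) (p : R) : 0 <= p <= 1 -> forall b, 0 <= bweight p b.
Proof.
move=> /andP[p0 p1] b; rewrite /bweight mulr_ge0// exprn_ge0//.
by rewrite subr_ge0.
Qed.

Lemma sum_bweight (R : realType) (p : R) (h : bool -> R) :
  \sum_b bweight p b * h b = p * h true + (1 - p) * h false.
Proof. by rewrite big_bool /bweight /= !expr1 !expr0 mulr1 mul1r. Qed.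

(** The weights of the four configurations on an adjacent pair x, y, the first
    index of e being the spin of x and e the feasibility of each, given the
    spins elsewhere.  If an empty x is feasible at all then so is the filled
    pair, and the worst case is that of e00, e01 and e11 only. *)
Lemma pair_single (R : realType) (p rho : R) (e00 e01 e10 e11 : bool) :
  0 <= p <= 1 -> 0 <= rho <= 1 ->
  1 - p <= rho * (1 - p + p ^+ 2) ->
  (1 - p) ^+ 2 <= rho ^+ 2 * ((1 - p) ^+ 2 + p ^+ 2) ->
  (e00%:R <= e11%:R :> R) -> (e01%:R <= e11%:R :> R) ->
  (1 - p) * (p * e01%:R + (1 - p) * e00%:R) <=
  rho * (p * (p * e11%:R + (1 - p) * e10%:R) +
         (1 - p) * (p * e01%:R + (1 - p) * e00%:R)).
Proof.
move=> /andP[p0 p1] /andP[r0 r1] rho1 rho2.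
have q0 : 0 <= 1 - p by lra.
have pq0 : 0 <= p * (1 - p) by rewrite mulr_ge0.
have rpq0 : 0 <= rho * (p * (1 - p)) by rewrite mulr_ge0.
have rp0 : 0 <= rho * p ^+ 2 by rewrite mulr_ge0// exprn_ge0.
have rq0 : 0 <= rho * (1 - p) ^+ 2 by rewrite mulr_ge0// exprn_ge0.
have qr : 1 - p <= rho by lra.
have pqr : p * (1 - p) <= p * rho by rewrite ler_wpM2l.
have r2 : (1 - p) ^+ 2 <= rho * ((1 - p) ^+ 2 + p ^+ 2).
  apply: le_trans rho2 _; rewrite ler_wpM2r ?addr_ge0 ?exprn_ge0//.
  by rewrite expr2 ler_piMl.
by rewrite !ler_nat; case: e00; case: e01; case: e10; case: e11 => //= _ _; lra.
Qed.

Lemma pair_double (R : realType) (p rho : R) (e00 e01 e10 e11 : bool) :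
  0 <= p <= 1 -> 0 <= rho <= 1 ->
  (1 - p) ^+ 2 <= rho ^+ 2 * ((1 - p) ^+ 2 + p ^+ 2) ->
  (e00%:R <= e11%:R :> R) ->
  (1 - p) * ((1 - p) * e00%:R) <=
  rho ^+ 2 * (p * (p * e11%:R + (1 - p) * e10%:R) +
         (1 - p) * (p * e01%:R + (1 - p) * e00%:R)).
Proof.
move=> /andP[p0 p1] /andP[r0 r1] rho2.
have q0 : 0 <= 1 - p by lra.
have r20 : 0 <= rho ^+ 2 by rewrite exprn_ge0.
have rpq0 : 0 <= rho ^+ 2 * (p * (1 - p)) by rewrite !mulr_ge0.
have rp0 : 0 <= rho ^+ 2 * p ^+ 2 by rewrite mulr_ge0// exprn_ge0.
have rq0 : 0 <= rho ^+ 2 * (1 - p) ^+ 2 by rewrite mulr_ge0// exprn_ge0.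
by rewrite !ler_nat; case: e00; case: e01; case: e10; case: e11 => //= _; lra.
Qed.

Section Feasibility.
Variables (R : realType) (T : choiceType) (adj : T -> T -> Prop).
Hypothesis adj_sym : forall x y, adj x y -> adj y x.
Hypothesis adj_irr : forall x, ~ adj x x.
Variable L : T -> Prop.
Implicit Types (w : T -> bool) (U V s : seq T).

Definition feasible w := forall x, L x -> w x -> exists2 y, adj y x & w y.

Definition feas w : R := (`[< feasible w >])%:R.

Definition zeros U w : R := (all (fun x => ~~ w x) U)%:R.

Lemma feas_ge0 w : 0 <= feas w. Proof. by rewrite ler0n. Qed.

Lemma zeros_ge0 U w : 0 <= zeros U w. Proof. by rewrite ler0n. Qed.

Lemma zeros_perm U V w : perm_eq U V -> zeros U w = zeros V w.
Proof. by move=> UV; rewrite /zeros (perm_all _ UV). Qed.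

Lemma zeros_cons x U w : zeros (x :: U) w = (~~ w x)%:R * zeros U w.
Proof. by rewrite /zeros /= -natrM mulnb. Qed.

Lemma zeros_upd x U w a : x \notin U -> zeros U (upd w x a) = zeros U w.
Proof.
move=> xU; rewrite /zeros; congr (_%:R); congr (nat_of_bool _).
apply: eq_in_all => y yU; rewrite /upd.
by case: eqP => // yx; move: xU; rewrite -yx yU.
Qed.

(** Two adjacent occupied sites support each other, and occupying further sites
    never harms the others. *)
Lemma feas_fill x y w a b : adj x y ->
  feas (upd (upd w x a) y b) <= feas (upd (upd w x true) y true).
Proof.
move=> xy; have nxy : x != y by apply/eqP => e; apply: (@adj_irr x); rewrite {2}e.
rewrite /feas ler_nat; case: asboolP => // fe; case: asboolP => //.
case=> z Lz; rewrite /upd; case: (eqVneq z y) => [->|zy] zo.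
  by exists x => //; case: eqP => // _; rewrite eqxx.
have [->|zx] := eqVneq z x.
  by exists y; [exact: adj_sym|rewrite eqxx].
have [] := fe z Lz; first by rewrite /upd (negbTE zy) (negbTE zx); move: zo; rewrite (negbTE zx).
move=> u uz uo; exists u => //.
by move: uo; rewrite /upd; case: ifP => //; case: ifP.
Qed.

Variables p rho : R.
Hypothesis p01 : 0 <= p <= 1.
Hypothesis rho01 : 0 <= rho <= 1.
Hypothesis rho1 : 1 - p <= rho * (1 - p + p ^+ 2).
Hypothesis rho2 : (1 - p) ^+ 2 <= rho ^+ 2 * ((1 - p) ^+ 2 + p ^+ 2).

Local Notation E := (avg (bweight p)).

Lemma perm_pair_last s x y : x \in s -> y \in s -> x != y ->
  perm_eq s (rem y (rem x s) ++ [:: x; y]).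
Proof.
move=> xs ys xy; rewrite perm_sym perm_catC perm_sym /=.
apply: (perm_trans (perm_to_rem xs)); rewrite perm_cons.
apply: perm_to_rem; move: ys; rewrite (perm_mem (perm_to_rem xs)) inE.
by rewrite eq_sym (negbTE xy).
Qed.

Lemma avg_pair x y f w : E [:: x; y] f w =
  p * (p * f (upd (upd w x true) y true) +
       (1 - p) * f (upd (upd w x true) y false)) +
  (1 - p) * (p * f (upd (upd w x false) y true) +
       (1 - p) * f (upd (upd w x false) y false)).
Proof. by rewrite /= !sum_bweight. Qed.

(** Removing one site x from the list U of empty sites gains a factor rho: for
    frozen spins elsewhere, a neighbor y of x that is not required to be empty
    can be filled together with x.  If y is itself required to be empty, both
    are removed and the gain is rho ^+ 2. *)
Lemma zeros_bound s U w : uniq U ->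
  (forall x, x \in U -> x \in s /\ exists2 y, y \in s & adj x y) ->
  E s (fun v => feas v * zeros U v) w <= rho ^+ size U * E s feas w.
Proof.
have w0 := bweight_ge0 p01; have [/andP[p0 p1] /andP[r0 r1]] := (p01, rho01).
move: {2}(size U) (leqnn (size U)) => n.
elim: n U => [|n IH] [|x U] //=.
- by move=> *; rewrite expr0 mul1r; apply: le_avg => // v _; rewrite mulr1.
- by move=> *; rewrite expr0 mul1r; apply: le_avg => // v _; rewrite mulr1.
rewrite ltnS => Un /andP[xU uU] H.
have [xs [y ys xy]] := H x (mem_head _ _).
have nxy : x != y by apply/eqP => e; apply: (@adj_irr x); rewrite {2}e.
have pe := perm_pair_last xs ys nxy.
have [yU|yU] := boolP (y \in U); last first.
  apply: (@le_trans _ _ (rho * E s (fun v => feas v * zeros U v) w)).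
    rewrite !(avg_perm _ _ w pe) !avg_cat -avgZ; apply: le_avg => // v _.
    rewrite !avg_pair !zeros_cons !zeros_upd//.
    have ux a b : upd (upd v x a) y b x = a by rewrite /upd (negbTE nxy) eqxx.
    rewrite !ux.
    have := @pair_single _ _ _ _ _ `[< feasible (upd (upd v x true) y false) >] _
      p01 rho01 rho1 rho2 (feas_fill v false false xy) (feas_fill v false true xy).
    rewrite -!/(feas _) => /(ler_wpM2l (zeros_ge0 U v)).
    set c := zeros U v; set f1 := feas _; set f2 := feas _; set f3 := feas _; set f4 := feas _.
    by rewrite /= => K; lra.
  rewrite exprS -mulrA ler_wpM2l//; apply: IH => // z zU.
  by apply: H; rewrite inE zU orbT.
have pU := perm_to_rem yU; set V := rem y U in pU.
have uV : uniq V by rewrite rem_uniq.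
have yV : y \notin V by rewrite mem_rem_uniq// inE eqxx.
have xV : x \notin V by apply: contra xU => /mem_rem.
apply: (@le_trans _ _ (rho ^+ 2 * E s (fun v => feas v * zeros V v) w)).
  rewrite !(avg_perm _ _ w pe) !avg_cat -avgZ; apply: le_avg => // v _.
  rewrite !avg_pair !zeros_cons !(zeros_perm _ pU) !zeros_cons !zeros_upd//.
  have ux a b : upd (upd v x a) y b x = a by rewrite /upd (negbTE nxy) eqxx.
  rewrite !ux.
  have uy a b : upd (upd v x a) y b y = b by rewrite /upd eqxx.
  rewrite !uy.
  have := @pair_double _ _ _ _ `[< feasible (upd (upd v x false) y true) >]
    `[< feasible (upd (upd v x true) y false) >] _
    p01 rho01 rho2 (feas_fill v false false xy).
  rewrite -!/(feas _) => /(ler_wpM2l (zeros_ge0 V v)).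
  set c := zeros V v; set f1 := feas _; set f2 := feas _; set f3 := feas _; set f4 := feas _.
  by rewrite /= => K; lra.
rewrite (perm_size pU) /= -/V.
have -> : rho ^+ (size V).+2 = rho ^+ 2 * rho ^+ size V by rewrite -exprD.
rewrite -mulrA ler_wpM2l ?exprn_ge0//; apply: IH => //.
  by apply: leq_trans Un; rewrite (perm_size pU) /= -/V leqnSn.
by move=> z /mem_rem zU; apply: H; rewrite inE zU orbT.
Qed.

End Feasibility.

(** * Two independent copies *)

Section Pairs.
Variables (R : realType) (T : choiceType) (p : R).
Implicit Types (w : T -> bool * bool) (s V : seq T).

Definition pweight (ab : bool * bool) : R := bweight p ab.1 * bweight p ab.2.

Definition lcopy w : T -> bool := fun x => (w x).1.
Definition rcopy w : T -> bool := fun x => (w x).2.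
Definition disag w x : bool := (w x).1 != (w x).2.

Lemma lcopy_upd w x ab : lcopy (upd w x ab) = upd (lcopy w) x ab.1.
Proof. by apply: funext => y; rewrite /lcopy /upd; case: ifP. Qed.

Lemma rcopy_upd w x ab : rcopy (upd w x ab) = upd (rcopy w) x ab.2.
Proof. by apply: funext => y; rewrite /rcopy /upd; case: ifP. Qed.

Lemma avg_pairs s (f g : (T -> bool) -> R) w :
  avg pweight s (fun v => f (lcopy v) * g (rcopy v)) w =
  avg (bweight p) s f (lcopy w) * avg (bweight p) s g (rcopy w).
Proof.
elim: s w => //= x s IH w.
rewrite big_distrlr pair_big; apply: eq_bigr => -[a b] _ /=.
by rewrite IH lcopy_upd rcopy_upd mulrACA.
Qed.

Definition swap (D : {fset T}) w : T -> bool * bool :=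
  fun x => if x \in D then ((w x).2, (w x).1) else w x.

(** The weight of a pair of spins is symmetric. *)
Lemma avg_swap (D : {fset T}) s f w : {subset D <= s} ->
  avg pweight s (fun v => f (swap D v)) w = avg pweight s f w.
Proof.
move=> Ds; transitivity (avg pweight s f (swap D w)); last first.
  by apply: avg_agree => x xs; rewrite /swap ifN//; apply: contra xs => /Ds.
elim: s {Ds} w => //= x s IH w; under eq_bigr do rewrite IH.
have [xD|xD] := boolP (x \in D).
  rewrite (reindex_inj (h := fun ab : bool * bool => (ab.2, ab.1))) /=; last first.
    by move=> [a b] [c d] [-> ->].
  apply: eq_bigr => -[a b] _; rewrite /pweight /= [bweight p b * _]mulrC.
  congr (_ * avg _ _ _ _); apply: funext => y; rewrite /swap /upd.
  by case: (eqVneq y x) => // ->; rewrite xD.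
apply: eq_bigr => -[a b] _; congr (_ * avg _ _ _ _); apply: funext => y.
by rewrite /swap /upd; case: (eqVneq y x) => // ->; rewrite (negbTE xD).
Qed.

Variables (adj : T -> T -> Prop) (L : T -> Prop).
Hypothesis adj_sym : forall x y, adj x y -> adj y x.
Hypothesis adj_irr : forall x, ~ adj x x.
Variable rho : R.
Hypothesis p01 : 0 <= p <= 1.
Hypothesis rho01 : 0 <= rho <= 1.
Hypothesis rho1 : 1 - p <= rho * (1 - p + p ^+ 2).
Hypothesis rho2 : (1 - p) ^+ 2 <= rho ^+ 2 * ((1 - p) ^+ 2 + p ^+ 2).

Local Notation F := (feas R adj L).
Local Notation Z := (zeros R).
Local Notation E := (avg (bweight p)).
Local Notation E2 := (avg pweight).

Lemma pweight_ge0 ab : 0 <= pweight ab.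
Proof. by rewrite mulr_ge0// bweight_ge0. Qed.

(** At a disagreement one of the copies is empty.  Each site of V is moved to
    the list A or B of that copy, which costs a factor 2; what remains is a
    product of an event for each copy. *)
Lemma disag_bound s A B V w : uniq (V ++ A) -> uniq (V ++ B) ->
  (forall x, x \in V ++ A ++ B -> x \in s /\ exists2 y, y \in s & adj x y) ->
  E2 s (fun v => F (lcopy v) * Z A (lcopy v) * (F (rcopy v) * Z B (rcopy v)) *
                 (all (disag v) V)%:R) w <=
  2 ^+ size V * rho ^+ (size V + (size A + size B)) *
  (E s F (lcopy w) * E s F (rcopy w)).
Proof.
have r0 : 0 <= rho by case/andP: rho01.
elim: V A B => [|x V IH] A B /=.
  move=> uA uB H; rewrite expr0 mul1r add0n exprD mulrACA.
  rewrite (eq_avg (g := fun v => F (lcopy v) * Z A (lcopy v) *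
      (F (rcopy v) * Z B (rcopy v)))); last by move=> v _; rewrite mulr1.
  rewrite (@avg_pairs s (fun v => F v * Z A v) (fun v => F v * Z B v)).
  have a0 C u : 0 <= E s (fun v => F v * Z C v) u.
    by apply: avg_ge0 => [a|v]; [exact: bweight_ge0|rewrite mulr_ge0 ?feas_ge0 ?zeros_ge0].
  by apply: ler_pM => //; apply: zeros_bound => // z zA; apply: H;
     rewrite mem_cat zA ?orbT.
move=> /andP[xVA uA] /andP[xVB uB] H.
have pc C : perm_eq (V ++ x :: C) (x :: V ++ C).
  by rewrite -cat1s perm_catCA.
apply: (@le_trans _ _ (
  E2 s (fun v => F (lcopy v) * Z (x :: A) (lcopy v) *
     (F (rcopy v) * Z B (rcopy v)) * (all (disag v) V)%:R) w +
  E2 s (fun v => F (lcopy v) * Z A (lcopy v) *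
     (F (rcopy v) * Z (x :: B) (rcopy v)) * (all (disag v) V)%:R) w)).
  rewrite -avgD; apply: le_avg => [a|v _]; first exact: pweight_ge0.
  rewrite !zeros_cons -mulnb natrM.
  set d := (all _ _)%:R; set a := Z A _; set b := Z B _; set f := F _; set g := F _.
  have h : 0 <= f * a * (g * b) * d.
    by rewrite !mulr_ge0 ?ler0n.
  have dx : (disag v x)%:R <= (~~ lcopy v x)%:R + (~~ rcopy v x)%:R :> R.
    by rewrite -natrD ler_nat /disag /lcopy /rcopy; case: (v x) => -[] [].
  have := ler_wpM2l h dx; set d1 := (disag v x)%:R.
  set e1 := (~~ _)%:R; set e2 := (~~ _)%:R => K.
  rewrite [leLHS](_ : _ = f * a * (g * b) * d * d1); last by ring.
  by apply: le_trans K _; rewrite le_eqVlt; apply/orP; left; apply/eqP; ring.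
have c0 : 0 <= E s F (lcopy w) * E s F (rcopy w).
  by rewrite mulr_ge0// avg_ge0// => *; rewrite ?bweight_ge0 ?feas_ge0.
have IA := IH (x :: A) B; have IB := IH A (x :: B).
apply: le_trans (lerD (IA _ uB _) (IB uA _ _)) _.
- by rewrite (perm_uniq (pc A)) /= xVA uA.
- move=> z K; apply: H; move: K; rewrite !(in_cons, mem_cat).
  by case: (z \in V); case: (z == x).
- by rewrite (perm_uniq (pc B)) /= xVB uB.
- move=> z K; apply: H; move: K; rewrite !(in_cons, mem_cat).
  by case: (z \in V); case: (z == x); case: (z \in A).
rewrite /= !addnS !addSn exprS [2 ^+ _.+1]exprS le_eqVlt; apply/orP; left; apply/eqP.
by ring.
Qed.

(** A site whose neighborhood lies in s either has a neighbor, so that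
    emptiness is costly, or is isolated and hence empty in both copies. *)
Lemma path_bound s V w : uniq V ->
  (forall x, x \in V -> [/\ L x, x \in s & forall y, adj x y -> y \in s]) ->
  E2 s (fun v => F (lcopy v) * F (rcopy v) * (all (disag v) V)%:R) w <=
  (2 * rho) ^+ size V * (E s F (lcopy w) * E s F (rcopy w)).
Proof.
move=> uV H; have r0 : 0 <= rho by case/andP: rho01.
have c0 : 0 <= E s F (lcopy w) * E s F (rcopy w).
  by rewrite mulr_ge0// avg_ge0// => *; rewrite ?bweight_ge0 ?feas_ge0.
have [nb|/existsNP[x /not_implyP[xV nx]]] :=
  pselect (forall x, x \in V -> exists y, adj x y).
  have := @disag_bound s [::] [::] V w; rewrite !cats0 addn0 -exprMn => /(_ uV uV) K.
  apply: le_trans (K _).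
    by apply: le_avg => [a|v _]; [exact: pweight_ge0|rewrite /zeros /= !mulr1].
  move=> x xV; have [_ xs ys] := H x xV; split => //.
  by have [y xy] := nb x xV; exists y => //; exact: ys.
apply: (@le_trans _ _ 0); last first.
  by rewrite mulr_ge0// exprn_ge0// mulr_ge0.
rewrite -[leRHS](mul0r (E2 s (fun=> 0) w)) -avgZ.
apply: le_avg => [a|v _]; first exact: pweight_ge0.
rewrite mul0r; have [Lx _ _] := H x xV.
have iso u : F u != 0 -> u x = false.
  rewrite /feas; case: asboolP => [fu _|]; last by rewrite eqxx.
  apply/negP => ux; have [y yx _] := fu x Lx ux.
  by apply: nx; exists y; exact: adj_sym.
have [->|/iso lx] := eqVneq (F (lcopy v)) 0; first by rewrite !mul0r.
have [->|/iso rx] := eqVneq (F (rcopy v)) 0; first by rewrite mulr0 mul0r.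
rewrite (_ : all _ _ = false) ?mulr0//; apply/allP => /(_ x xV).
by rewrite /disag; move: lx rx; rewrite /lcopy /rcopy => -> ->.
Qed.

End Pairs.

(** * Clusters of disagreement *)

Section Clusters.
Variables (T : choiceType) (near : T -> seq T).
Implicit Types (D r : seq T) (X : pred T).

Fixpoint reach D n : seq T :=
  if n is k.+1 then reach D k ++ flatten [seq near x | x <- reach D k] else D.

(** Breadth-first exploration of the clusters in X that meet D. *)
Fixpoint layer X D n : seq T :=
  if n is k.+1 then
    layer X D k ++ [seq y <- flatten [seq near x | x <- layer X D k] | X y]
  else [seq x <- D | X x].

(** Paths are listed from their last site backwards.  A step may not lead to a
    site that was already in reach one step earlier. *)
Definition extend r : seq (seq T) :=
  match r with
  | [::] => [::]
  | [:: x] => [seq [:: z; x] | z <- near x]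
  | x :: y :: _ => [seq z :: r | z <- near x & (z != y) && (z \notin near y)]
  end.

Fixpoint paths D n : seq (seq T) :=
  if n is k.+1 then flatten [seq extend r | r <- paths D k]
  else [seq [:: x] | x <- D].

Lemma reachS D n x : x \in reach D n -> x \in reach D n.+1.
Proof. by rewrite /= mem_cat => ->. Qed.

Lemma reach_near D n x y : x \in reach D n -> y \in near x -> y \in reach D n.+1.
Proof.
move=> xn yx; rewrite /= mem_cat; apply/orP; right.
by apply/flatten_mapP; exists x.
Qed.

Lemma layerS X D n x : x \in layer X D n -> x \in layer X D n.+1.
Proof. by rewrite /= mem_cat => ->. Qed.

Lemma layer_near X D n x y :
  x \in layer X D n -> y \in near x -> X y -> y \in layer X D n.+1.
Proof.
move=> xn yx Xy; rewrite /= mem_cat mem_filter Xy; apply/orP; right.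
by apply/flatten_mapP; exists x.
Qed.

Lemma layer_sub X D n x : x \in layer X D n -> X x /\ x \in reach D n.
Proof.
elim: n x => [|n IH] x /=; first by rewrite mem_filter => /andP[].
rewrite mem_cat => /orP[/IH[Xx xn]|].
  by split => //; exact: reachS.
rewrite mem_filter => /andP[Xx /flatten_mapP[y yn xy]]; split => //.
by apply: reach_near xy; case: (IH _ yn).
Qed.

Lemma eq_layer X Y D n : X =1 Y -> layer X D n = layer Y D n.
Proof. by move=> XY; elim: n => [|n /= ->]; [|congr (_ ++ _)]; exact: eq_filter. Qed.

(** The first site reached at step n is the end of a path along which each site
    is first reached one step after its predecessor; this is why the steps of
    the path avoid the surroundings of the last but one site. *)
Lemma layer_path X D n x : x \in layer X D n ->
  (0 < n -> x \notin layer X D n.-1)%N ->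
  exists r, [/\ x :: r \in paths D n, all X (x :: r), uniq (x :: r) &
                forall y, y \in r -> y \in layer X D n.-1].
Proof.
elim: n x => [|n IH] x.
  rewrite /= mem_filter => /andP[Xx xD] _; exists [::]; split => //.
    by apply/mapP; exists x.
  by rewrite /= Xx.
move=> xn1 /(_ isT); rewrite -[n.+1.-1]/n => xNn.
have := xn1; rewrite /= mem_cat (negbTE xNn) /= mem_filter => /andP[Xx /flatten_mapP[y yn xy]].
have yNn : (0 < n -> y \notin layer X D n.-1)%N.
  case: n yn xNn {IH xn1} => // n yn xNn _ /=; apply: contra xNn => yn'.
  exact: (layer_near yn').
have [r [rp rX ru rn]] := IH y yn yNn.
exists (y :: r); split.
- apply/flattenP; exists (extend (y :: r)); first exact: map_f.
  case: r rp {rX ru} rn => [|z r] rp rn; first by apply/mapP; exists x.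
  have := rn z (mem_head _ _) => zn.
  have n0 : (0 < n)%N by case: n rp {xn1 xNn IH yn yNn rn zn} => // /mapP[].
  rewrite -(prednK n0) in xNn *; apply: map_f; rewrite mem_filter xy andbT.
  apply/andP; split.
    by apply: contra xNn => /eqP ->; exact: layerS.
  by apply: contra xNn => xz; exact: (layer_near zn).
- by rewrite /= Xx.
- rewrite cons_uniq; apply/andP; split=> //; rewrite inE negb_or; apply/andP; split.
    by apply: contra xNn => /eqP ->.
  apply: contra xNn => /rn; case: n {IH yn yNn rp rn xn1} => // n; exact: layerS.
- move=> z; rewrite inE => /orP[/eqP->//|/rn].
  by case: n {IH yn yNn rp rn xn1 xNn} => // n; exact: layerS.
Qed.

Lemma paths_reach D n r x : r \in paths D n -> x \in r -> x \in reach D n.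
Proof.
elim: n r x => [|n IH] r x /=.
  by move=> /mapP[y yD ->]; rewrite inE => /eqP ->.
move=> /flattenP[_ /mapP[t tp ->]] rt xr.
have [z [y [u [tE rE zy]]]] : exists z y u, [/\ t = y :: u, r = z :: t & z \in near y].
  case: t rt {tp} => [//|y [|y' u]] /mapP[z]; last rewrite mem_filter => /andP[_].
    by move=> zy ->; exists z, y, [::].
  by move=> zy ->; exists z, y, (y' :: u).
move: xr; rewrite rE inE => /orP[/eqP ->|/IH]; last by move=> /(_ tp); exact: reachS.
by apply: reach_near zy; apply: IH tp _; rewrite tE mem_head.
Qed.

Lemma size_path D n r : r \in paths D n -> size r = n.+1.
Proof.
elim: n r => [|n IH] r /=; first by move=> /mapP[y yD ->].
move=> /flattenP[_ /mapP[t tp ->]]; move: (IH t tp).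
case: t {tp} => [//|y [|y' u]] <- /mapP[z]; last rewrite mem_filter => /andP[_].
  by move=> zy ->.
by move=> zy ->.
Qed.

Lemma size_flatten_le (A B : eqType) (f : A -> seq B) (s : seq A) c :
  (forall x, x \in s -> (size (f x) <= c)%N) ->
  (size (flatten [seq f x | x <- s]) <= size s * c)%N.
Proof.
elim: s => //= x s IH H; rewrite size_cat mulSn leq_add ?H ?mem_head//.
by apply: IH => y ys; apply: H; rewrite inE ys orbT.
Qed.

Variables N b : nat.
Hypothesis near_size : forall x, (size (near x) <= N)%N.
Hypothesis near_step : forall y x, x \in near y ->
  (size [seq z <- near x | (z != y) && (z \notin near y)] <= b)%N.

Lemma size_paths D n : (size (paths D n.+1) <= size D * N * b ^ n)%N.
Proof.
elim: n => [|n IH].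
  rewrite expn0 muln1 /= -[X in (_ <= X * _)%N](size_map (fun x => [:: x])).
  by apply: size_flatten_le => _ /mapP[x _ ->]; rewrite size_map.
rewrite expnSr mulnA; apply: leq_trans (leq_mul IH (leqnn b)).
apply: size_flatten_le => r.
move=> /flattenP[_ /mapP[t tp ->]].
case: t {tp} => [//|y [|y' u]] /mapP[z]; last rewrite mem_filter => /andP[_].
  by move=> zy -> /=; rewrite size_map near_step.
by move=> zy -> /=; rewrite size_map near_step.
Qed.

End Clusters.

(** * Comparison of two boundary conditions *)

Section Comparison.
Variables (R : realType) (T : choiceType) (p rho : R).
Variables (adj : T -> T -> Prop) (L : T -> Prop).
Hypothesis adj_sym : forall x y, adj x y -> adj y x.
Hypothesis adj_irr : forall x, ~ adj x x.
Hypothesis p01 : 0 <= p <= 1.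
Hypothesis rho01 : 0 <= rho <= 1.
Hypothesis rho1 : 1 - p <= rho * (1 - p + p ^+ 2).
Hypothesis rho2 : (1 - p) ^+ 2 <= rho ^+ 2 * ((1 - p) ^+ 2 + p ^+ 2).

Definition star (z x : T) := x = z \/ adj x z.

Variable near : T -> seq T.
Hypothesis star_near : forall z x y, star z x -> star z y -> x != y -> y \in near x.
Variables N b : nat.
Hypothesis near_size : forall x, (size (near x) <= N)%N.
Hypothesis near_step : forall y x, x \in near y ->
  (size [seq z <- near x | (z != y) && (z \notin near y)] <= b)%N.

Local Notation F := (feas R adj L).
Local Notation E := (avg (bweight p)).
Local Notation E2 := (avg (pweight p)).
Implicit Types (w : T -> bool * bool) (D : seq T) (C : {fset T}).

Lemma disag_swap C w : disag (swap C w) =1 disag w.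
Proof. by move=> x; rewrite /disag /swap; case: ifP => //; rewrite eq_sym. Qed.

Lemma swapK C : involutive (@swap T C).
Proof.
by move=> w; apply: funext => x; rewrite /swap; case: (x \in C); case: (w x).
Qed.

Definition stable D n w : bool :=
  all [in layer near (disag w) D n] (layer near (disag w) D n.+1).

Definition cluster D n w : {fset T} := [fset x in layer near (disag w) D n]%fset.

Lemma layer_swap C D n w :
  layer near (disag (swap C w)) D n = layer near (disag w) D n.
Proof. by apply: eq_layer; exact: disag_swap. Qed.

Lemma stable_swap C D n w : stable D n (swap C w) = stable D n w.
Proof. by rewrite /stable !layer_swap. Qed.

Lemma cluster_swap C D n w : cluster D n (swap C w) = cluster D n w.
Proof. by rewrite /cluster layer_swap. Qed.

(** The disagreements inside one star are pairwise near, so a full cluster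
    contains all of them or none: seen from one constraint, exchanging the
    copies on the cluster either does nothing or exchanges the copies. *)
Lemma swap_feasible D n w : stable D n w ->
  feasible adj L (lcopy w) -> feasible adj L (rcopy w) ->
  feasible adj L (lcopy (swap (cluster D n w) w)) /\
  feasible adj L (rcopy (swap (cluster D n w) w)).
Proof.
move=> /allP st fl fr; set C := cluster D n w.
have mC x : (x \in C) = (x \in layer near (disag w) D n) by rewrite !inE.
have all_or_none z : (forall x, star z x -> swap C w x = w x) \/
    (forall x, star z x -> swap C w x = ((w x).2, (w x).1)).
  have [[x zx xC]|none] := pselect (exists2 x, star z x & x \in C); last first.
    left=> x zx; rewrite /swap ifN//; apply/negP => xC; apply: none.
    by exists x.
  right=> y zy; rewrite /swap; case: ifPn => // yC.
  suff : ~~ disag w y by rewrite /disag negbK; case: (w y) => a c /= /eqP ->.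
  apply: contra yC => wy; rewrite mC; apply: st.
  have xn : x \in layer near (disag w) D n by rewrite -mC.
  have [<-|xy] := eqVneq x y; first exact: layerS.
  by apply: (layer_near xn) => //; exact: (star_near zx).
split=> z Lz; rewrite /lcopy /rcopy; have [h|h] := all_or_none z.
- rewrite h; last by left.
  by move=> wz; have [y yz wy] := fl z Lz wz; exists y => //; rewrite h//; right.
- rewrite h; last by left.
  by move=> wz; have [y yz wy] := fr z Lz wz; exists y => //; rewrite h//; right.
- rewrite h; last by left.
  by move=> wz; have [y yz wy] := fr z Lz wz; exists y => //; rewrite h//; right.
- rewrite h; last by left.
  by move=> wz; have [y yz wy] := fl z Lz wz; exists y => //; rewrite h//; right.
Qed.

Lemma swap_feas D n w : stable D n w ->
  F (lcopy (swap (cluster D n w) w)) * F (rcopy (swap (cluster D n w) w)) =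
  F (lcopy w) * F (rcopy w).
Proof.
move=> st; rewrite /feas -!natrM !mulnb -!asbool_and; congr (nat_of_bool _)%:R.
apply: asbool_equiv_eq; split=> -[fl fr]; last exact: swap_feasible.
have := @swap_feasible D n (swap (cluster D n w) w).
by rewrite stable_swap cluster_swap swapK => /(_ st fl fr).
Qed.

(** On D itself the cluster contains every disagreement. *)
Lemma swap_observable D n w (f : (T -> bool) -> R) :
  (forall v v', {in D, v =1 v'} -> f v = f v') ->
  f (lcopy (swap (cluster D n w) w)) = f (rcopy w) /\
  f (rcopy (swap (cluster D n w) w)) = f (lcopy w).
Proof.
move=> fD; have sw x : x \in D -> swap (cluster D n w) w x = ((w x).2, (w x).1).
  move=> xD; rewrite /swap; case: ifPn => // xC.
  suff : ~~ disag w x by rewrite /disag negbK; case: (w x) => a c /= /eqP ->.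
  apply: contra xC => wx; rewrite !inE.
  by elim: n => [|n IH]; [rewrite /= mem_filter wx|exact: layerS].
by split; apply: fD => x xD; rewrite /lcopy /rcopy sw.
Qed.

Lemma normr_avg s (f g : (T -> bool * bool) -> R) w :
  (forall v, `|f v| <= g v) -> `|E2 s f w| <= E2 s g w.
Proof.
have m0 := pweight_ge0 p01.
move=> fg; rewrite ler_norml -avgN; apply/andP; split; apply: le_avg => // v _.
  by have := fg v; rewrite ler_norml => /andP[].
exact: le_trans (ler_norm _) (fg v).
Qed.

(** On the event that the exploration from D stops within n steps, exchanging
    the copies on the explored cluster changes the sign of f (lcopy v) - f (rcopy v),
    so this event contributes nothing.  Otherwise there is a path of n.+2
    disagreements, and the bound is a sum over all candidate paths. *)
Lemma compare_boundaries s D n (f : (T -> bool) -> R) w :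
  (forall v v', {in D, v =1 v'} -> f v = f v') -> (forall v, 0 <= f v <= 1) ->
  {subset reach near D n.+2 <= s} -> (forall x, x \in s -> L x) ->
  `|E s (fun v => F v * f v) (lcopy w) * E s F (rcopy w) -
    E s F (lcopy w) * E s (fun v => F v * f v) (rcopy w)| <=
  (size D * N * b ^ n)%:R * (2 * rho) ^+ n.+2 *
    (E s F (lcopy w) * E s F (rcopy w)).
Proof.
move=> fD f01 Ds sL; have r0 : 0 <= rho by case/andP: rho01.
have m0 := pweight_ge0 p01.
have c0 : 0 <= E s F (lcopy w) * E s F (rcopy w).
  by rewrite mulr_ge0// avg_ge0// => *; rewrite ?bweight_ge0 ?feas_ge0.
pose h (v : T -> bool * bool) := F (lcopy v) * F (rcopy v) * (f (lcopy v) - f (rcopy v)).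
have -> : E s (fun v => F v * f v) (lcopy w) * E s F (rcopy w) -
    E s F (lcopy w) * E s (fun v => F v * f v) (rcopy w) = E2 s h w.
  rewrite -!avg_pairs -avgN -avgD; apply: eq_avg => v _.
  by rewrite /h; ring.
have -> : E2 s h w = E2 s (fun v => h v * (stable D n v)%:R) w +
    E2 s (fun v => h v * (~~ stable D n v)%:R) w.
  rewrite -avgD; apply: eq_avg => v _.
  by case: (stable D n v) => /=; rewrite mulr0 mulr1 ?addr0 ?add0r.
have -> : E2 s (fun v => h v * (stable D n v)%:R) w = 0.
  (* The cluster is random: the exchange is made for each of its values C. *)
  pose S := [fset x in s]%fset.
  pose g C v : R := h v * (stable D n v)%:R * (cluster D n v == C)%:R.
  have clS v : cluster D n v \in fpowerset S.
    rewrite fpowersetE; apply/fsubsetP => x; rewrite !inE => /layer_sub[_ xB].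
    by apply: Ds; apply: reachS; exact: reachS.
  rewrite (eq_avg (g := fun v => \sum_(C <- fpowerset S) g C v)); last first.
    move=> v _; rewrite (bigD1_seq _ (clS v) (fset_uniq _)) /= big1_seq ?addr0.
      by rewrite /g eqxx mulr1.
    by move=> C /andP[Cv _]; rewrite /g eq_sym (negbTE Cv) mulr0.
  rewrite avg_sum big1_seq// => C /andP[_]; rewrite fpowersetE => /fsubsetP CS.
  suff : E2 s (g C) w = - E2 s (g C) w by lra.
  rewrite -[LHS](@avg_swap R T p C); last by move=> x /CS; rewrite !inE.
  rewrite -avgN; apply: eq_avg => v _.
  rewrite /g stable_swap cluster_swap.
  case: eqP => [cl|]; last by rewrite !mulr0 oppr0.
  case: (boolP (stable D n v)) => [st|]; last by rewrite !mulr0 !mul0r oppr0.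
  rewrite !mulr1 /h -cl swap_feas//; have [-> ->] := @swap_observable D n v f fD.
  by ring.
rewrite add0r.
pose P := [seq r <- paths near D n.+1 | uniq r].
apply: (@le_trans _ _ (\sum_(r <- P)
    E2 s (fun v => F (lcopy v) * F (rcopy v) * (all (disag v) r)%:R) w)).
  rewrite -avg_sum; apply: normr_avg => v.
  have t0 r : 0 <= F (lcopy v) * F (rcopy v) * (all (disag v) r)%:R.
    by rewrite !mulr_ge0 ?ler0n.
  case: (boolP (stable D n v)) => [_|]; first by rewrite mulr0 normr0 sumr_ge0.
  move=> /allPn[x xn xNn]; rewrite mulr1.
  have [r [rp rX ru _]] := layer_path xn (fun=> xNn).
  have rP : x :: r \in P by rewrite mem_filter ru.
  rewrite (big_rem _ rP) /= -[leLHS]addr0; apply: lerD; last exact: sumr_ge0.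
  have -> : disag v x && all (disag v) r by [].
  rewrite mulr1 /h normrM ger0_norm ?mulr_ge0 ?feas_ge0// ler_piMr ?mulr_ge0 ?feas_ge0//.
  have /andP[? ?] := f01 (lcopy v); have /andP[? ?] := f01 (rcopy v).
  by rewrite ler_norml; apply/andP; split; lra.
set c := (2 * rho) ^+ n.+2 * (E s F (lcopy w) * E s F (rcopy w)).
apply: (@le_trans _ _ (\sum_(r <- P) c)).
  rewrite big_seq [leRHS]big_seq; apply: ler_sum => r.
  rewrite mem_filter => /andP[ru rp]; rewrite /c -(size_path rp).
  apply: path_bound => // x xr; have xb := paths_reach rp xr.
  have xs : x \in s by apply: Ds; apply: reachS.
  split=> // [|y xy]; first exact: sL.
  apply: Ds; apply: (reach_near xb); apply: (@star_near x); [by left| |].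
    by right; exact: adj_sym.
  by apply/eqP => exy; apply: (@adj_irr x); rewrite {2}exy.
rewrite big_const_seq iter_addr_0 count_predT -mulrA -/c -[leLHS]mulr_natl.
apply: ler_wpM2r; first by rewrite mulr_ge0// exprn_ge0// mulr_ge0.
rewrite ler_nat size_filter (leq_trans (count_size _ _))//.
exact: size_paths.
Qed.

End Comparison.

(** * The range-two neighborhoods of the lattice *)

Section Lattice.
Variable d : nat.
Implicit Types (x y z : site d) (f g : 'I_d -> int) (a b k : 'I_d).

Definition dist x y : nat := (\sum_(k < d) `|x k - y k|)%N.

Lemma adj_dist x y : adj x y <-> dist x y = 1%N.
Proof.
rewrite /adj /dist; have -> : \sum_(k < d) `|x k - y k| =
    (\sum_(k < d) `|x k - y k|)%N%:Z :> int.
  by rewrite (big_morph Posz PoszD (erefl _)); apply: eq_bigr.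
by split=> [[]|->].
Qed.

Lemma distC x y : dist x y = dist y x.
Proof. by apply: eq_bigr => k _; lia. Qed.

Lemma dist_triangle y x z : (dist x z <= dist x y + dist y z)%N.
Proof. by rewrite /dist -big_split; apply: leq_sum => k _ /=; lia. Qed.

Lemma dist_eq0 x y : (dist x y == 0%N) = (x == y).
Proof.
rewrite /dist sum_nat_eq0; apply/forallP/eqP => [h|-> k]; last first.
  by rewrite subrr.
by apply/ffunP => k; have /= := h k; lia.
Qed.

Definition shift x f : site d := [ffun k => x k + f k].

Definition unit a k : int := (k == a)%:R.

Lemma dist_shift x f g :
  dist (shift x f) (shift x g) = (\sum_(k < d) `|(f k - g k)%R|)%N.
Proof. by apply: eq_bigr => k _; rewrite !ffunE opprD addrACA subrr add0r. Qed.

Lemma shift0 x : shift x (fun=> 0) = x.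
Proof. by apply/ffunP => k; rewrite ffunE addr0. Qed.

Lemma norm_combination (i j : int) a b f :
  (forall k, f k = i * unit a k + j * unit b k) ->
  (\sum_(k < d) `|f k| <= `|i| + `|j|)%N.
Proof.
move=> fE; apply: (@leq_trans (\sum_(k < d) ((k == a) * `|i| + (k == b) * `|j|)))%N.
  apply: leq_sum => k _; rewrite fE /unit.
  by case: (k == a); case: (k == b); lia.
rewrite big_split /= leq_add//.
  by rewrite (bigD1 a)//= eqxx big1 ?addn0 ?mul1n// => k /negbTE ->.
by rewrite (bigD1 b)//= eqxx big1 ?addn0 ?mul1n// => k /negbTE ->.
Qed.

(** Codes for the vectors of norm one or two: an axis and a sign for the unit
    vectors; for the others a pair of axes and a sign, where the order of the
    axes tells whether the two nonzero entries have the same sign, and equal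
    axes stand for a doubled unit vector. *)
Definition code := ('I_d * bool + 'I_d * 'I_d * bool)%type.

Definition sign (e : bool) : int := if e then 1 else -1.

Definition vector (c : code) : 'I_d -> int :=
  match c with
  | inl (a, e) => fun k => sign e * unit a k
  | inr (a, b, e) => fun k =>
      sign e * unit a k + sign (e (+) (b < a)%N) * unit b k
  end.

Lemma card_code : #|{: code}| = (2 * d + 2 * d ^ 2)%N.
Proof. by rewrite card_sum !card_prod card_ord card_bool; lia. Qed.

Definition near0 x : seq (site d) :=
  [seq z <- undup [seq shift x (vector c) | c : code] | (z != x) && (dist x z <= 2)%N].

Lemma size_near0 x : (size (near0 x) <= 2 * d + 2 * d ^ 2)%N.
Proof.
rewrite size_filter (leq_trans (count_size _ _))// (leq_trans (size_undup _))//.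
by rewrite size_image card_code.
Qed.

Lemma near0_uniq x : uniq (near0 x).
Proof. by rewrite filter_uniq// undup_uniq. Qed.

Lemma vector_code f : (0 < \sum_(k < d) `|f k| <= 2)%N ->
  exists c, forall k, f k = vector c k.
Proof.
move=> /andP[f0 f2].
have [a fa] : exists a, f a != 0.
  apply/existsP; rewrite -negb_forall; apply: contraTN f0 => /forallP h.
  by rewrite big1// => k _; have /eqP -> : f k == 0 by rewrite -[_ == _]negbK h.
have [/forallP others|] := boolP [forall k, (k != a) ==> (f k == 0)].
  have f0k k : k != a -> f k = 0 by move=> ka; have /implyP/(_ ka)/eqP := others k.
  have fa2 : (`|f a| <= 2)%N.
    by move: f2; rewrite (bigD1 a)//=; lia.
  have [fa1|fa1] := eqVneq `|f a|%N 1%N.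
    exists (inl (a, 0 < f a)) => k /=; rewrite /unit /sign.
    by case: (eqVneq k a) => [->|/f0k ->]; [case: ifP|]; lia.
  exists (inr (a, a, 0 < f a)) => k /=; rewrite /unit /sign ltnn addbF.
  by case: (eqVneq k a) => [->|/f0k ->]; [case: ifP|]; lia.
rewrite negb_forall => /existsP[b]; rewrite negb_imply => /andP[ba fb].
have := f2; rewrite (bigD1 a)//= (bigD1 b)//= => f2'.
have f0k k : k != a -> k != b -> f k = 0.
  move=> ka kb; move: f2'; rewrite (bigD1 k) ?ka ?kb//=; lia.
have {f2'} [fa1 fb1] : `|f a|%N = 1%N /\ `|f b|%N = 1%N by lia.
have ab : a == b = false by rewrite eq_sym (negbTE ba).
have [same|opp] := eqVneq (f a) (f b).
  have [lt|gt|e] := ltngtP a b; last by rewrite (ord_inj e) eqxx in ba.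
    exists (inr (a, b, 0 < f a)) => k /=.
    rewrite /unit /sign ltnNge (ltnW lt) addbF; case: (boolP (0 < f a)) => /= s;
    have [->|ka] := eqVneq k a; rewrite ?ab; try lia;
    by have [->|kb] := eqVneq k b; [|rewrite (f0k k)]; lia.
  exists (inr (b, a, 0 < f a)) => k /=.
  rewrite /unit /sign ltnNge (ltnW gt) addbF; case: (boolP (0 < f a)) => /= s;
  have [->|ka] := eqVneq k a; rewrite ?ab; try lia;
  by have [->|kb] := eqVneq k b; [|rewrite (f0k k)]; lia.
have [lt|gt|e] := ltngtP a b; last by rewrite (ord_inj e) eqxx in ba.
  exists (inr (b, a, 0 < f b)) => k /=.
  rewrite /unit /sign lt addbT; case: (boolP (0 < f b)) => /= s;
  have [->|ka] := eqVneq k a; rewrite ?ab; try lia;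
  by have [->|kb] := eqVneq k b; [|rewrite (f0k k)]; lia.
exists (inr (a, b, 0 < f a)) => k /=.
rewrite /unit /sign gt addbT; case: (boolP (0 < f a)) => /= s;
have [->|ka] := eqVneq k a; rewrite ?ab; try lia;
by have [->|kb] := eqVneq k b; [|rewrite (f0k k)]; lia.
Qed.

Lemma mem_near0 x z : (z \in near0 x) = (z != x) && (dist x z <= 2)%N.
Proof.
rewrite mem_filter; case: (boolP ((z != x) && _)) => //= /andP[zx xz2].
rewrite mem_undup; have [|c cE] := @vector_code (fun k => z k - x k).
  have -> : (\sum_(k < d) `|(z k - x k)%R|)%N = dist x z by rewrite distC.
  by rewrite xz2 lt0n dist_eq0 eq_sym zx.
apply/mapP; exists c; first by rewrite mem_enum.
apply/ffunP => k.
by rewrite ffunE -cE addrC subrK.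
Qed.

(** Four common neighbors of x and y, y itself included, leave at most
    2 * d + 2 * d ^ 2 - 4 steps from x out of reach of y. *)
Lemma near0_step (d2 : (2 <= d)%N) y x : x \in near0 y ->
  (size [seq z <- near0 x | (z != y) && (z \notin near0 y)] <=
   2 * d + 2 * d ^ 2 - 4)%N.
Proof.
move=> /[dup] xy; rewrite mem_filter mem_undup => /andP[/andP[xNy xy2] /mapP[c _ xE]].
pose Q z := (z != y) && (z \notin near0 y).
suff [zs [uzs szs zsx zsQ]] : exists zs, [/\ uniq zs, size zs = 4%N,
    {subset zs <= near0 x} & all (predC Q) zs].
  rewrite leq_subRL; last by lia.
  apply: leq_trans (size_near0 x).
  rewrite -(count_predC Q) size_filter addnC leq_add2l -szs -size_filter.
  apply: uniq_leq_size => // z zzs; rewrite mem_filter zsx// andbT.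
  exact: (allP zsQ).
have other a : exists b, b != a.
  have [->|a0] := eqVneq a (Ordinal (ltnW d2)).
    by exists (Ordinal d2).
  by exists (Ordinal (ltnW d2)); rewrite eq_sym.
pose differ (f g : 'I_d -> int) := exists k, f k != g k.
pose close (f g : 'I_d -> int) := exists i j a b, (`|i| + `|j| <= 2)%N /\
  forall k, f k - g k = i * unit a k + j * unit b k.
have differP f g : differ f g -> (shift y f == shift y g) = false.
  move=> [k fg]; apply/negbTE; apply: contra fg => /eqP/ffunP/(_ k).
  by rewrite !ffunE => /addrI ->.
have closeP f g : close f g -> (dist (shift y f) (shift y g) <= 2)%N.
  move=> [i [j [a [b [ij fg]]]]]; rewrite dist_shift (leq_trans _ ij)//.
  exact: (norm_combination fg).
have y0 := shift0 y; set f0 : 'I_d -> int := (fun=> 0) in y0.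
(* It suffices to give three displacements from y. *)
have finish (f1 f2 f3 : 'I_d -> int) :
    [/\ differ f0 f1, differ f0 f2 & differ f0 f3] ->
    [/\ differ f1 f2, differ f1 f3 & differ f2 f3] ->
    [/\ differ f1 (vector c), differ f2 (vector c) & differ f3 (vector c)] ->
    [/\ close (vector c) f1, close (vector c) f2 & close (vector c) f3] ->
    [/\ close f0 f1, close f0 f2 & close f0 f3] ->
    exists zs, [/\ uniq zs, size zs = 4%N,
      {subset zs <= near0 x} & all (predC Q) zs].
  move=> [/differP n01 /differP n02 /differP n03].
  move=> [/differP n12 /differP n13 /differP n23].
  move=> [/differP n1 /differP n2 /differP n3].
  move=> [/closeP c1 /closeP c2 /closeP c3] [/closeP c01 /closeP c02 /closeP c03].
  rewrite -!xE !y0 in n01 n02 n03 n1 n2 n3 c1 c2 c3 c01 c02 c03.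
  exists [:: y; shift y f1; shift y f2; shift y f3]; split=> //.
  - by rewrite /= !inE n01 n02 n03 n12 n13 n23.
  - move=> z; rewrite !inE => /or4P[]/eqP->; rewrite mem_near0 ?n1 ?n2 ?n3//.
    by rewrite eq_sym xNy distC.
  - by rewrite /= /Q !mem_near0 eqxx c01 c02 c03 !andbT /= !andbN.
have sgn e : `|sign e|%N = 1%N by case: e.
have unitE a b k : a != b -> k = a -> unit b k = 0 /\ unit a k = 1.
  by move=> ab ->; rewrite /unit eqxx (negbTE ab).
case: c xE finish => [[a e]|[[a b] e]] _ /= finish.
  have [b ba] := other a; have ab : a != b by rewrite eq_sym.
  have [ba0 aa1] := unitE _ _ a ab erefl; have [ab0 bb1] := unitE _ _ b ba erefl.
  have := sgn e; move: (sign e) finish => s finish s1.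
  apply: (finish (unit b) (fun k => - unit b k) (fun k => - s * unit a k)).
  - by split; [exists b|exists b|exists a]; rewrite /f0 ?aa1 ?bb1; lia.
  - by split; exists b; rewrite ?ab0 bb1; lia.
  - by split; [exists b|exists b|exists a]; rewrite ?ab0 ?bb1 ?aa1; lia.
  - split; [exists s, (-1), a, b|exists s, 1, a, b|exists s, s, a, a];
      (split; [lia|by move=> k /=; ring]).
  - split; [exists (-1), 0, b, b|exists 1, 0, b, b|exists s, 0, a, a];
      (split; [lia|by move=> k; rewrite /f0; ring]).
have [ab|ab] := eqVneq a b; last first.
  have ba : b != a by rewrite eq_sym.
  have [ba0 aa1] := unitE _ _ a ab erefl; have [ab0 bb1] := unitE _ _ b ba erefl.
  have := sgn e; have := sgn (e (+) (b < a)%N).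
  move: (sign (e (+) (b < a)%N)) (sign e) finish => t s finish t1 s1.
  apply: (finish (fun k => s * unit a k) (fun k => t * unit b k)
                 (fun k => 2 * s * unit a k)).
  - by split; [exists a|exists b|exists a]; rewrite /f0 ?aa1 ?bb1; lia.
  - by split; exists a; rewrite ?ba0 ?aa1; lia.
  - by split; [exists b|exists a|exists b]; rewrite ?ab0 ?bb1 ?ba0 ?aa1; lia.
  - split; [exists t, 0, b, b|exists s, 0, a, a|exists (- s), t, a, b];
      (split; [lia|by move=> k /=; ring]).
  - split; [exists (- s), 0, a, a|exists (- t), 0, b, b|exists (- s), (- s), a, a];
      (split; [lia|by move=> k; rewrite /f0; ring]).
rewrite -ab ltnn addbF in finish; clear b ab.
have [b ba] := other a; have ab : a != b by rewrite eq_sym.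
have [ba0 aa1] := unitE _ _ a ab erefl; have [ab0 bb1] := unitE _ _ b ba erefl.
have := sgn e; move: (sign e) finish => s finish s1.
apply: (finish (fun k => s * unit a k) (fun k => s * unit a k + unit b k)
               (fun k => s * unit a k - unit b k)).
- by split; exists a; rewrite /f0 ?ba0 ?aa1; lia.
- by split; exists b; rewrite ?ab0 ?bb1; lia.
- by split; exists a; rewrite ?ba0 ?aa1; lia.
- split; [exists s, 0, a, a|exists s, (-1), a, b|exists s, 1, a, b];
    (split; [lia|by move=> k /=; ring]).
- split; [exists (- s), 0, a, a|exists (- s), (-1), a, b|exists (- s), 1, a, b];
    (split; [lia|by move=> k; rewrite /f0; ring]).
Qed.

End Lattice.

(** * The model on a subset of the lattice *)

Section Subset.
Variables (d : nat) (S : set (site d)).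
Implicit Types x y z : S.

Definition sadj x y : Prop := adj (val x) (val y).

Definition snear x : seq S := pmap insub (near0 (val x)).

Lemma sadj_sym x y : sadj x y -> sadj y x.
Proof. by rewrite /sadj !adj_dist distC. Qed.

Lemma sadj_irr x : ~ sadj x x.
Proof. by rewrite /sadj adj_dist => h; have := dist_eq0 (val x) (val x); rewrite h eqxx. Qed.

Lemma mem_snear x z : (z \in snear x) = (z != x) && (dist (val x) (val z) <= 2)%N.
Proof. by rewrite mem_pmap_sub mem_near0. Qed.

Lemma star_snear z x y : star sadj z x -> star sadj z y -> x != y -> y \in snear x.
Proof.
have le1 u : star sadj z u -> (dist (val u) (val z) <= 1)%N.
  by case=> [->|/adj_dist ->//]; have /eqP -> : dist (val z) (val z) == 0%N by rewrite dist_eq0.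
move=> /le1 zx /le1 zy xy; rewrite mem_snear eq_sym xy /=.
by apply: leq_trans (dist_triangle (val z) _ _) _; rewrite (distC (val z)) -[2%N]addn1 leq_add.
Qed.

Lemma size_snear x : (size (snear x) <= 2 * d + 2 * d ^ 2)%N.
Proof.
apply: leq_trans (size_near0 (val x)).
by rewrite size_pmap_sub count_size.
Qed.

Lemma snear_step (d2 : (2 <= d)%N) y x : x \in snear y ->
  (size [seq z <- snear x | (z != y) && (z \notin snear y)] <=
   2 * d + 2 * d ^ 2 - 4)%N.
Proof.
rewrite mem_pmap_sub => xy; apply: leq_trans (near0_step d2 xy).
rewrite -(size_map val); apply: uniq_leq_size.
  by rewrite map_inj_uniq ?filter_uniq ?pmap_sub_uniq ?near0_uniq//; exact: val_inj.
move=> u /mapP[z zf ->]; rewrite mem_filter.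
by move: zf; rewrite mem_filter /snear !mem_pmap_sub.
Qed.

End Subset.

(** * The density threshold *)

Section Threshold.
Variable R : realType.

(** A polynomial in q = 1 - p that exceeds the costs q / (1 - p * q) of a
    single empty site and q / Num.sqrt (1 - 2 * p * q) per site of an empty
    pair, both of which are q + q ^ 2 to second order, and that still leaves
    room below the threshold. *)
Definition empty_rate (p : R) : R := (1 - p) * (1 + 3 / 2 * (1 - p)).

Lemma above_threshold (d : nat) (p : R) : (2 <= d)%N -> p_c R d < p ->
  0 < p /\ (1 - p ^+ 2) * (2 * d + 2 * d ^ 2 - 3)%N%:R < 1.
Proof.
move=> d2 hp.
have p0 : 0 < p by apply: le_lt_trans hp; exact: sqrtr_ge0.
split=> //; move: hp; rewrite /p_c.
have n9 : 9 <= (2 * d + 2 * d ^ 2 - 3)%N%:R :> R.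
  by rewrite ler_nat; nia.
have nE : (2 * d + 2 * d ^ 2 - 3)%N%:R = 2 * d%:R ^+ 2 + 2 * d%:R - 3 :> R.
  by rewrite natrB; [rewrite natrD !natrM; ring|nia].
rewrite nE in n9 *; set n := _ - 3 in n9 *.
have -> : 2 * d%:R ^+ 2 + 2 * d%:R - 4 = n - 1 :> R by rewrite /n; ring.
have x0 : 0 <= (n - 1) / n by rewrite divr_ge0//; lra.
rewrite -(ltr_pXn2r (n := 2))// ?nnegrE ?sqrtr_ge0 ?(ltW p0)//.
rewrite sqr_sqrtr// ltr_pdivrMr//; last by lra.
by move=> h; lra.
Qed.

Lemma empty_rate_spec (p : R) (n : nat) : (9 <= n)%N -> 0 < p -> p < 1 ->
  (1 - p ^+ 2) * n%:R < 1 ->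
  [/\ 0 <= empty_rate p <= 1,
      1 - p <= empty_rate p * (1 - p + p ^+ 2),
      (1 - p) ^+ 2 <= empty_rate p ^+ 2 * ((1 - p) ^+ 2 + p ^+ 2) &
      2 * empty_rate p * (n - 1)%N%:R < 1].
Proof.
move=> n9 p0 p1 h; rewrite natrB; last by rewrite (leq_trans _ n9).
have {n9} n9 : 9 <= n%:R :> R by rewrite ler_nat.
move: (n%:R) n9 h => N n9 h; rewrite /empty_rate.
have [q qE] : exists q, q = 1 - p by exists (1 - p).
have pE : p = 1 - q by rewrite qE; ring.
rewrite pE in p0 p1 h *; clear qE pE.
have -> : 1 - (1 - q) = q by ring.
have q0 : 0 < q by lra.
have q1 : q <= 1 / 9.
  have : q * (2 - q) * 9 < 1.
    apply: le_lt_trans h; rewrite (_ : 1 - (1 - q) ^+ 2 = q * (2 - q)); last by ring.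
    by rewrite ler_wpM2l// mulr_ge0; lra.
  have : q <= q * (2 - q) by rewrite ler_peMr; lra.
  by lra.
have q2 : 0 <= q ^+ 2 by rewrite exprn_ge0// ltW.
have q3 : 0 <= q ^+ 3 by rewrite exprn_ge0// ltW.
have q2' : q ^+ 2 <= q / 9 by rewrite expr2 ler_wpM2l; lra.
have q3' : q ^+ 3 <= q ^+ 2 / 9 by rewrite exprSr ler_wpM2l; lra.
split.
- by apply/andP; split; lra.
- by rewrite -[leRHS]mulrA ler_peMr; lra.
- rewrite exprMn -[leRHS]mulrA ler_peMr//.
  have q4 : 0 <= q ^+ 4 by rewrite exprn_ge0// ltW.
  by lra.
- have e : 2 * (q * (1 + 3 / 2 * q)) * (N - 1) * (2 - q) =
     2 * (1 + 3 / 2 * q) * ((1 - (1 - q) ^+ 2) * N - (1 - (1 - q) ^+ 2)) by ring.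
  have : 2 * (1 + 3 / 2 * q) * ((1 - (1 - q) ^+ 2) * N - (1 - (1 - q) ^+ 2)) <
         2 * (1 + 3 / 2 * q) * (1 - (1 - (1 - q) ^+ 2)).
    by rewrite ltr_pM2l; lra.
  rewrite -e => k; have : 2 * (q * (1 + 3 / 2 * q)) * (N - 1) * (2 - q) < 1 * (2 - q).
    by apply: lt_le_trans k _; lra.
  by rewrite ltr_pM2r//; lra.
Qed.

Lemma cvg_geometric_bound (a c r : R) : 0 <= c -> 0 <= a -> 0 <= r -> r * c < 1 ->
  forall e, 0 < e -> exists n, a * c ^+ n * r ^+ n.+2 < e.
Proof.
move=> c0 a0 r0 rc1 e e0.
have rc0 : 0 <= r * c by rewrite mulr_ge0.
have : (fun n => (a * r ^+ 2) * (r * c) ^+ n) @ \oo --> (0 : R)%R.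
  by apply: cvg_geometric; rewrite ger0_norm.
move=> /cvgr0_norm_lt /(_ e e0) [n _ /(_ n (leqnn n))] h; exists n.
apply: le_lt_trans (ler_norm _) _.
by rewrite (_ : _ * _ = a * r ^+ 2 * (r * c) ^+ n)// exprMn -addn2 exprD; ring.
Qed.

End Threshold.

(** * Finite-volume averages *)

(** By induction along an enumeration of V, the sum being first restricted to
    the functions that agree with w off the part already enumerated. *)
Lemma avg_ffun (R : realType) (T : eqType) (K V : finType) (m : K -> R)
    (emb : V -> T) (glue : {ffun V -> K} -> (T -> K) -> T -> K)
    (f : (T -> K) -> R) (w : T -> K) :
  injective emb ->
  (forall eta v x, (forall k, x != emb k) -> glue eta v x = v x) ->
  (forall eta v k, glue eta v (emb k) = eta k) ->
  \sum_(eta : {ffun V -> K}) (\prod_k m (eta k)) * f (glue eta w) = avg m [seq emb k | k <- enum V] f w.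
Proof.
move=> emb_inj gout gin.
have gext eta v v' : (forall x, (forall k, x != emb k) -> v x = v' x) ->
    glue eta v = glue eta v'.
  move=> vv'; apply: funext => x.
  have [[k xk]|nx] := pselect (exists k, x = emb k); first by rewrite xk !gin.
  have nx' k : x != emb k by apply/eqP => xk; apply: nx; exists k.
  by rewrite !gout// vv'.
suff general (r : seq V) w' : uniq r ->
    \sum_(eta : {ffun V -> K} | [forall k, (k \in r) || (eta k == w' (emb k))])
      (\prod_(k <- r) m (eta k)) * f (glue eta w') =
    avg m [seq emb k | k <- r] f w'.
  rewrite -general ?enum_uniq//; apply: eq_big => [eta|eta _].
    by symmetry; apply/forallP => k; rewrite mem_enum.
  by rewrite big_enum.
elim: r w' => [|x r IH] w' /=.
  move=> _; rewrite (big_pred1 [ffun k => w' (emb k)]) => [|eta].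
    rewrite big_nil mul1r; congr f; apply: funext => y.
    have [[k ->]|ny] := pselect (exists k, y = emb k); first by rewrite gin ffunE.
    by rewrite gout// => k; apply/eqP => yk; apply: ny; exists k.
  apply/forallP/eqP => [h|-> k]; last by rewrite ffunE eqxx.
  by apply/ffunP => k; rewrite ffunE; apply/eqP; exact: h.
move=> /andP[xr ur].
rewrite (partition_big (fun eta : {ffun V -> K} => eta x) predT)//=.
apply: eq_bigr => a _; rewrite -IH// mulr_sumr.
apply: eq_big => [eta|eta /andP[_ /eqP <-]].
  apply/andP/forallP => [[/forallP h /eqP xa] k|h].
    have [->|kx] := eqVneq k x; first by rewrite /upd eqxx xa eqxx orbT.
    by have := h k; rewrite inE (negbTE kx) /upd (inj_eq emb_inj) (negbTE kx).
  split; last by have := h x; rewrite (negbTE xr) /upd eqxx.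
  apply/forallP => k; have := h k; rewrite inE /upd (inj_eq emb_inj).
  by have [|kx] := eqVneq k x.
rewrite big_cons -mulrA; congr (_ * (_ * f _)); apply: gext => y ny.
by rewrite /upd (negbTE (ny x)).
Qed.

Lemma avg_depends (R : realType) (T : eqType) (K : finType) (m : K -> R) s
    (P : T -> Prop) (f : (T -> K) -> R) w w' :
  (forall v v', (forall x, P x -> v x = v' x) -> f v = f v') ->
  (forall x, P x -> w x = w' x) -> avg m s f w = avg m s f w'.
Proof.
move=> fP; elim: s w w' => [|x s IH] w w' ww' /=; first exact: fP.
apply: eq_bigr => a _; congr (_ * _); apply: IH => y Py.
by rewrite /upd; case: (y == x) => //; exact: ww'.
Qed.

Section Kernel.
Variables (R : realType) (d : nat) (p : R) (S : set (site d)).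
Implicit Types (D : {fset site d}) (v w : S -> bool) (f : (S -> bool) -> R).

Lemma mem_inside D i : (i \in inside S D) = (i \in D) && (i \in S).
Proof. by rewrite /inside in_fset. Qed.

Lemma inside_mem D (k : inside S D) : fsval k \in S.
Proof. by have := fsvalP k; rewrite mem_inside => /andP[]. Qed.

Definition emb D (k : inside S D) : S := Sub (fsval k) (inside_mem k).

Definition sites D : seq S := [seq emb k | k <- enum {: inside S D}].

Lemma emb_inj D : injective (@emb D).
Proof. by move=> j k /(congr1 val); rewrite !SubK => /val_inj. Qed.

Lemma mem_sites D x : (x \in sites D) = (val x \in D).
Proof.
apply/mapP/idP => [[k _ ->]|xD].
  by rewrite SubK; have := fsvalP k; rewrite mem_inside => /andP[].
have xin : val x \in inside S D by rewrite mem_inside xD; exact: valP.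
by exists [` xin]; [rewrite mem_enum|apply: val_inj; rewrite SubK].
Qed.

Lemma sites_uniq D : uniq (sites D).
Proof. by rewrite map_inj_uniq ?enum_uniq//; exact: emb_inj. Qed.

Lemma concat_emb D (eta : local_config S D) v k : concat eta v (emb k) = eta k.
Proof.
rewrite /concat SubK; case: insubP => [k' _ kk'|]; last by rewrite fsvalP.
by congr (eta _); apply: val_inj.
Qed.

Lemma concat_out D (eta : local_config S D) v x :
  val x \notin D -> concat eta v x = v x.
Proof.
move=> xD; rewrite /concat insubN//; apply: contra xD.
by rewrite mem_inside => /andP[].
Qed.

Lemma cylinder_concat D (eta zeta : local_config S D) v :
  cylinder eta (concat zeta v) <-> zeta = eta.
Proof.
split=> [h|-> x k xk].
  by apply/ffunP => k; rewrite -(concat_emb zeta v); apply: h; rewrite SubK.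
have -> : x = emb k by apply: val_inj; rewrite SubK.
exact: concat_emb.
Qed.

Definition region D : S -> Prop := fun x => extension [set` D] (val x).

Local Notation E := (avg (bweight p)).
Local Notation F D := (feas R (@sadj d S) (region D)).

Lemma sum_local_config D f v :
  \sum_(eta : local_config S D) bernoulli_weight p eta * f (concat eta v) =
  E (sites D) f v.
Proof.
rewrite -(@avg_ffun _ _ _ _ (bweight p) _ (@concat d S D))//.
- exact: emb_inj.
- move=> eta u x nx; apply: concat_out; apply/negP => xD.
  have : x \in sites D by rewrite mem_sites.
  by move=> /mapP[k _ xk]; have := nx k; rewrite xk eqxx.
- by move=> eta u k; exact: concat_emb.
Qed.

Definition gibbs_avg D f v : R := E (sites D) (fun u => F D u * f u) v / E (sites D) (F D) v.

Definition indic (A : set (S -> bool)) v : R := (`[< A v >])%:R.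

Lemma kernelE D (eta : local_config S D) v :
  first_layer_kernel p eta v = gibbs_avg D (indic (cylinder eta)) v.
Proof.
rewrite /first_layer_kernel /gibbs_avg -!sum_local_config; congr (_ / _).
rewrite (bigD1 eta)//= big1 ?addr0; last first.
  move=> zeta /eqP ze; rewrite /indic; case: asboolP => [/cylinder_concat//|_].
  by rewrite !mulr0.
rewrite /indic; case: asboolP => [_|]; last by move=> h; exfalso; apply/h/cylinder_concat.
by rewrite mulr1.
Qed.

Hypothesis p01 : 0 < p < 1.

Let p01' : 0 <= p <= 1. Proof. by case/andP: p01 => /ltW -> /ltW ->. Qed.

Let w0 := bweight_ge0 p01'.

Lemma partition_ge0 D v : 0 <= E (sites D) (F D) v.
Proof. by apply: avg_ge0 => // u; exact: feas_ge0. Qed.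

(** With an empty boundary the empty configuration is feasible. *)
Lemma partition_empty_gt0 D : 0 < E (sites D) (F D) (fun=> false).
Proof.
have : 0 < F D (fun=> false).
  by rewrite /feas; case: asboolP => [_|h]; [rewrite ltr01|exfalso; apply: h].
move: (F D) (@feas_ge0 R S (@sadj d S) (region D)) => f f0 h.
elim: (sites D) => //= x s IH; rewrite sum_bweight ltr_wpDl//.
  by rewrite mulr_ge0 ?avg_ge0//; case/andP: p01 => /ltW.
rewrite mulr_gt0//; first by rewrite subr_gt0; case/andP: p01.
suff -> : upd (fun=> false) x false = (fun=> false) by [].
by apply: funext => y; rewrite /upd; case: ifP.
Qed.

Lemma gibbs_avg1 D : gibbs_avg D (fun=> 1) (fun=> false) = 1.
Proof.
rewrite /gibbs_avg (eq_avg (g := F D)) ?divff ?gt_eqF ?partition_empty_gt0//.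
by move=> u _; rewrite mulr1.
Qed.

Lemma gibbs_avg_sum (I : Type) (r : seq I) (P : pred I) D (f : I -> _ -> R) v :
  gibbs_avg D (fun u => \sum_(i <- r | P i) f i u) v =
  \sum_(i <- r | P i) gibbs_avg D (f i) v.
Proof.
rewrite /gibbs_avg -mulr_suml -avg_sum; congr (_ / _).
by apply: eq_avg => u _; rewrite mulr_sumr.
Qed.

Lemma gibbs_avgD D f g v :
  gibbs_avg D (fun u => f u + g u) v = gibbs_avg D f v + gibbs_avg D g v.
Proof.
rewrite /gibbs_avg -mulrDl -avgD; congr (_ / _).
by apply: eq_avg => u _; rewrite mulrDr.
Qed.

Lemma gibbs_avgZ c D f v : gibbs_avg D (fun u => c * f u) v = c * gibbs_avg D f v.
Proof.
rewrite /gibbs_avg mulrA -avgZ; congr (_ / _).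
by apply: eq_avg => u _; rewrite mulrCA.
Qed.

Lemma le_gibbs_avg D f g v : (forall u, f u <= g u) -> gibbs_avg D f v <= gibbs_avg D g v.
Proof.
move=> fg; rewrite /gibbs_avg ler_wpM2r ?invr_ge0 ?partition_ge0//.
by apply: le_avg => // u _; rewrite ler_wpM2l ?feas_ge0.
Qed.

Lemma gibbs_avg_ge0 D f v : (forall u, 0 <= f u) -> 0 <= gibbs_avg D f v.
Proof.
move=> f0; rewrite /gibbs_avg divr_ge0 ?partition_ge0//.
by apply: avg_ge0 => // u; rewrite mulr_ge0 ?feas_ge0.
Qed.

Lemma gibbs_avg_le1 D f v : (forall u, f u <= 1) -> gibbs_avg D f v <= 1.
Proof.
move=> f1; apply: le_trans (le_gibbs_avg D v f1) _.
rewrite /gibbs_avg (eq_avg (g := F D)); last by move=> u _; rewrite mulr1.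
have [->|Z0] := eqVneq (E (sites D) (F D) v) 0; first by rewrite mul0r ler01.
by rewrite divff.
Qed.

(** The constraints that involve the smaller volume are the only ones that are
    not constant when that volume is averaged out. *)
Lemma gibbs_avg_consistent (D D' : {fset site d}) f v :
  (D `<=` D')%fset -> (forall u, 0 <= f u <= 1) ->
  gibbs_avg D' (gibbs_avg D f) v = gibbs_avg D' f v.
Proof.
move=> DD' f01.
pose u := [seq x <- sites D' | val x \notin D].
have pe : perm_eq (sites D') (u ++ sites D).
  apply: uniq_perm.
  - exact: sites_uniq.
  - rewrite cat_uniq filter_uniq ?sites_uniq// andbT.
    by apply/hasPn => x; rewrite mem_sites mem_filter => ->.
  - move=> x; rewrite mem_cat mem_filter !mem_sites.
    case: (boolP (val x \in D)) => [xD|_]; last by rewrite orbF.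
    by rewrite (fsubsetP DD' _ xD).
pose H := feas R (@sadj d S) (fun x => region D' x /\ ~ region D x).
have FE w : F D' w = H w * F D w.
  rewrite /H /feas -natrM mulnb -asbool_and; congr (nat_of_bool _)%:R.
  apply: asbool_equiv_eq; split=> [h|[h1 h2] x Dx].
    split=> x; first by case=> + _; exact: h.
    move=> Dx; apply: h; case: Dx => [xD|[i iD ix]]; first by left; exact: (fsubsetP DD' _ xD).
    by right; exists i => //; exact: (fsubsetP DD' _ iD).
  have [?|?] := pselect (region D x); first exact: h2.
  exact: h1.
have Hloc w w' : agree_off (sites D) w w' -> H w = H w'.
  have sub a c : agree_off (sites D) a c ->
      feasible (@sadj d S) (fun x => region D' x /\ ~ region D x) a ->
      feasible (@sadj d S) (fun x => region D' x /\ ~ region D x) c.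
    move=> ac fa x [Dx nx] cx.
    have xD : x \notin sites D by rewrite mem_sites; apply/negP => xD; apply: nx; left.
    have [|y yx ay] := fa x (conj Dx nx); first by rewrite ac.
    exists y => //; rewrite -ac// mem_sites; apply/negP => yD.
    by apply: nx; right; exists (val y); [exact: yD|exact: sadj_sym].
  move=> ww'; rewrite /H /feas; congr (nat_of_bool _)%:R; apply: asbool_equiv_eq.
  by split; apply: sub => // x xD; rewrite ww'.
have Gloc w w' : agree_off (sites D) w w' -> H w * gibbs_avg D f w = H w' * gibbs_avg D f w'.
  by move=> ww'; rewrite (Hloc _ _ ww') /gibbs_avg !(avg_agree ww').
rewrite /gibbs_avg; congr (_ / _); rewrite !(avg_perm _ _ v pe) !avg_cat.
apply: eq_avg => w _.
rewrite (eq_avg (g := fun a => (H a * gibbs_avg D f a) * F D a)); last first.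
  by move=> a _; rewrite FE mulrAC.
rewrite avg_pull// (eq_avg (f := fun a => F D' a * f a)
  (g := fun a => H a * (F D a * f a))); last first.
  by move=> a _; rewrite FE mulrA.
rewrite avg_pull// -mulrA /gibbs_avg; congr (_ * _).
have [Z0|Z0] := eqVneq (E (sites D) (F D) w) 0; last by rewrite divfK.
rewrite Z0 mulr0; apply/esym/eqP; rewrite eq_le; apply/andP; split.
  rewrite -Z0; apply: le_avg => // a _; rewrite ler_piMr ?feas_ge0//.
  by case/andP: (f01 a).
apply: avg_ge0 => // a; rewrite mulr_ge0 ?feas_ge0//.
by case/andP: (f01 a).
Qed.

End Kernel.

(** * Loss of memory of the boundary *)

HB.instance Definition _ (d : nat) := Countable.copy (site d) {ffun 'I_d -> int}.

Section Memory.
Variables (R : realType) (d : nat) (p : R) (S : set (site d)).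
Hypothesis d2 : (2 <= d)%N.
Hypothesis hp : p_c R d < p.
Hypothesis hp1 : p < 1.
Implicit Types (D : {fset site d}) (v w : S -> bool) (f : (S -> bool) -> R).

Let p0 : 0 < p. Proof. by have [] := above_threshold d2 hp. Qed.

Let p01 : 0 < p < 1. Proof. by rewrite p0 hp1. Qed.

Local Notation G := (gibbs_avg p).

Definition depends D f := forall v w, (forall x : S, val x \in D -> v x = w x) -> f v = f w.

(** The boundary v is compared with the empty one, which always admits a
    feasible configuration.  The average of the constant 1 is 1 or 0 according
    to whether v admits one, so that the estimate holds without a condition on
    v and can be integrated. *)
Lemma boundary_influence D f (e : R) : depends D f -> (forall v, 0 <= f v <= 1) -> 0 < e ->
  exists D0, forall D', (D0 `<=` D')%fset -> forall v,
    `|G D' f v - G D' f (fun=> false) * G D' (fun=> 1) v| <= e.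
Proof.
move=> fD f01 e0; have [_ ht] := above_threshold d2 hp.
have n9 : (9 <= 2 * d + 2 * d ^ 2 - 3)%N by nia.
have [rho01 rho1 rho2 rhoN] := empty_rate_spec n9 p0 hp1 ht.
have r0 : 0 <= empty_rate p by case/andP: rho01.
have bE : (2 * d + 2 * d ^ 2 - 3 - 1 = 2 * d + 2 * d ^ 2 - 4)%N by lia.
rewrite bE in rhoN; clear bE.
have [n Kn] := cvg_geometric_bound (ler0n _ _)
  (ler0n R (size (sites S D) * (2 * d + 2 * d ^ 2))) (mulr_ge0 (ler0n _ 2) r0) rhoN e0.
have p01' : 0 <= p <= 1 by rewrite (ltW p0) (ltW hp1).
exists [fset val x | x in reach (@snear d S) (sites S D) n.+2]%fset => D' D0D' v.
pose w x := (v x, false).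
have := @compare_boundaries R S p (empty_rate p) (@sadj d S) (region D')
  (@sadj_sym d S) (@sadj_irr d S) p01' rho01 rho1 rho2 (@snear d S)
  (@star_snear d S) _ _ (@size_snear d S) (@snear_step d S d2)
  (sites S D') (sites S D) n f w.
have -> : lcopy w = v by [].
have -> : rcopy w = (fun=> false) by [].
have fD' : forall v v' : S -> bool, {in sites S D, v =1 v'} -> f v = f v'.
  by move=> u u' uu'; apply: fD => x xD; apply: uu'; rewrite mem_sites.
have reach_in : {subset reach (@snear d S) (sites S D) n.+2 <= sites S D'}.
  move=> x xb; rewrite mem_sites; apply: (fsubsetP D0D').
  by apply/imfsetP; exists x.
have in_region x : x \in sites S D' -> region D' x by rewrite mem_sites => xD; left.
move=> /(_ fD' f01 reach_in in_region).
rewrite /gibbs_avg; set Nv := avg _ _ _ v; set Zv := avg _ _ _ v.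
set Z0 := avg _ _ _ (fun=> false); set N0 := avg _ _ _ (fun=> false).
set K := _ * _ ^+ n.+2 => h.
have -> : avg (bweight p) (sites S D') (fun u => feas R (@sadj d S) (region D') u * 1) v = Zv.
  by apply: eq_avg => u _; rewrite mulr1.
have Z0p : 0 < Z0 by exact: partition_empty_gt0.
have [Zv0|Zvn] := eqVneq Zv 0.
  by rewrite Zv0 invr0 !mulr0 subrr normr0 ltW.
have Zvp : 0 < Zv by rewrite lt_neqAle eq_sym Zvn partition_ge0.
have -> : Nv / Zv - N0 / Z0 * (Zv / Zv) = (Nv * Z0 - Zv * N0) / (Zv * Z0).
  by field; rewrite Zvn gt_eqF.
rewrite normrM normfV (gtr0_norm (mulr_gt0 Zvp Z0p)) ler_pdivrMr ?mulr_gt0//.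
apply: le_trans h _; rewrite ler_pM2r ?mulr_gt0//; apply: le_trans (ltW Kn).
by rewrite /K natrM natrX.
Qed.

(** Any exhaustion of the lattice by finite sets would do; this one follows an
    enumeration of the sites. *)
Definition box (n : nat) : {fset site d} :=
  [fset x in pmap (fun i : nat => choice.unpickle i : option (site d)) (iota 0 n)]%fset.

Lemma mem_box (x : site d) n : (choice.pickle x < n)%N -> x \in box n.
Proof.
move=> xn; rewrite !inE mem_pmap; apply/mapP.
by exists (choice.pickle x); rewrite ?mem_iota// choice.pickleK.
Qed.

Lemma box_mono m n : (m <= n)%N -> (box m `<=` box n)%fset.
Proof.
move=> mn; apply/fsubsetP => x; rewrite !inE !mem_pmap => /mapP[k km ->].
by apply: map_f; move: km; rewrite !mem_iota /= !add0n => /leq_trans; exact.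
Qed.

Lemma box_exhausts D : exists n, (D `<=` box n)%fset.
Proof.
exists (\max_(x <- D) choice.pickle x).+1.
apply/fsubsetP => x xD; apply: mem_box; rewrite ltnS.
exact: (leq_bigmax_seq x xD isT).
Qed.

Definition free_avg n f : R := G (box n) f (fun=> false).

Definition state f : R := limn (fun n => free_avg n f).

(** By consistency the average in a larger volume is an average of averages in
    the smaller one, over random boundaries. *)
Lemma free_avg_stays D f (e : R) : depends D f -> (forall v, 0 <= f v <= 1) -> 0 < e ->
  exists m, forall n, (m <= n)%N -> `|free_avg n f - free_avg m f| <= e.
Proof.
move=> fD f01 e0; have [D0 h] := boundary_influence fD f01 e0.
have [m D0m] := box_exhausts D0; exists m => n mn.
have mbox := box_mono mn.
have G01 v : 0 <= G (box m) f v <= 1.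
  rewrite gibbs_avg_ge0 ?gibbs_avg_le1//; first by move=> u; case/andP: (f01 u).
  by move=> u; case/andP: (f01 u).
have one01 (u : S -> bool) : 0 <= (1 : R) <= 1 by rewrite ler01 lexx.
have fE : free_avg n f = G (box n) (G (box m) f) (fun=> false).
  by rewrite gibbs_avg_consistent.
have oneE : G (box n) (G (box m) (fun=> 1)) (fun _ : S => false) = 1.
  by rewrite gibbs_avg_consistent// gibbs_avg1.
have cE c : G (box n) (fun=> c) (fun _ : S => false) = c.
  by rewrite -[RHS]mulr1 -[in RHS](gibbs_avg1 S p01 (box n)) -gibbs_avgZ;
    apply: congr2 => //; apply: funext => u; rewrite mulr1.
rewrite ler_distl fE; apply/andP; split.
  rewrite lerBlDr -[X in _ <= _ + X]cE -gibbs_avgD.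
  rewrite -[leLHS]mulr1 -oneE -gibbs_avgZ; apply: le_gibbs_avg => // u.
  by have := h _ D0m u; rewrite ler_distl => /andP[+ _]; rewrite lerBlDr.
rewrite -[X in _ <= _ + X]cE -[X in _ <= X + _]mulr1 -oneE -gibbs_avgZ -gibbs_avgD.
apply: le_gibbs_avg => // u.
by have := h _ D0m u; rewrite ler_distl => /andP[].
Qed.

Lemma cvg_state D f : depends D f -> (forall v, 0 <= f v <= 1) ->
  free_avg n f @[n --> \oo] --> state f.
Proof.
move=> fD f01; apply: cauchy_cvg; apply: cauchy_exP => e e0.
have [m h] := free_avg_stays fD f01 (divr_gt0 e0 (ltr0n _ 2)).
exists (free_avg m f); exists m => // n /= /h.
by rewrite /ball /= distrC => /le_lt_trans; apply; rewrite ltr_pdivrMr//; lra.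
Qed.

End Memory.

Arguments box {d} n.
Arguments box_mono {d m n}.

(** * Local events and uniqueness *)

Section Local.
Variables (R : realType) (d : nat) (p : R) (S : set (site d)).
Implicit Types (D : {fset site d}) (v w : S -> bool) (f : (S -> bool) -> R).

Definition local_event : set (set (S -> bool)) :=
  [set A | exists D, forall v w, (forall x : S, val x \in D -> v x = w x) -> A v -> A w].

Lemma local_eventE A : local_event A <-> exists D, depends D (indic R A).
Proof.
split=> [[D AD]|[D AD]]; exists D => v w vw.
  rewrite /indic; congr (nat_of_bool _)%:R; apply: asbool_equiv_eq.
  by split; apply: AD => // x xD; rewrite vw.
move=> Av; have := AD v w vw; rewrite /indic; case: asboolP => // _.
by case: asboolP => // _ /eqP; rewrite oner_eq0.
Qed.

Lemma depends_sub D D' f : (D `<=` D')%fset -> depends D f -> depends D' f.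
Proof. by move=> DD' fD v w vw; apply: fD => x xD; apply: vw; exact: (fsubsetP DD' _ xD). Qed.

Definition restrict D v : local_config S D := [ffun k => v (emb k)].

Lemma concat_restrict D v w (x : S) : val x \in D -> concat (restrict D v) w x = v x.
Proof.
rewrite -mem_sites => /mapP[k _ ->].
by rewrite concat_emb ffunE.
Qed.

Lemma cylinder_restrict D v eta : cylinder eta v <-> restrict D v = eta.
Proof.
split=> [h|<- x k xk]; first by apply/ffunP => k; rewrite ffunE; apply: h; rewrite SubK.
by rewrite ffunE; congr v; apply: val_inj; rewrite SubK.
Qed.


Lemma local_expansion D f v : depends D f ->
  f v = \sum_(eta : local_config S D) f (concat eta (fun=> false)) * indic R (cylinder eta) v.
Proof.
move=> fD; rewrite (bigD1 (restrict D v))//= big1 ?addr0; last first.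
  move=> eta ev; rewrite /indic; case: asboolP => [/cylinder_restrict e|_].
    by rewrite -e eqxx in ev.
  by rewrite mulr0.
rewrite /indic; case: asboolP => [_|]; last by case; exact/cylinder_restrict.
by rewrite mulr1; apply: fD => x xD; rewrite concat_restrict.
Qed.

Lemma restrict_eq D v w : (forall x : S, val x \in D -> v x = w x) ->
  restrict D v = restrict D w.
Proof.
move=> vw; apply/ffunP => k; rewrite !ffunE; apply: vw.
by rewrite -mem_sites; apply: map_f; rewrite mem_enum.
Qed.

Lemma depends_cylinder D (eta : local_config S D) : depends D (indic R (cylinder eta)).
Proof.
move=> v w /restrict_eq vw; rewrite /indic; congr (nat_of_bool _)%:R.
apply: asbool_equiv_eq; split=> /cylinder_restrict h; apply/cylinder_restrict.
  by rewrite -vw.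
by rewrite vw.
Qed.

Definition range D : {fset site d} := [fset x in reach (@near0 d) D 2]%fset.

Lemma mem_range D x : (x \in range D) = (x \in reach (@near0 d) D 2).
Proof. by rewrite /range; move: (reach _ _ _) => r; rewrite !inE. Qed.

Lemma sub_range D : (D `<=` range D)%fset.
Proof. by apply/fsubsetP => x xD; rewrite mem_range; do 2 apply: reachS. Qed.

Lemma reach_adj n D (x y : site d) :
  x \in reach (@near0 d) D n -> adj x y -> y \in reach (@near0 d) D n.+1.
Proof.
move=> xn /adj_dist xy; apply: (reach_near xn); rewrite mem_near0 xy andbT.
by rewrite -dist_eq0 distC xy.
Qed.

Lemma depends_gibbs_avg D f : depends D f -> depends (range D) (gibbs_avg p D f).
Proof.
move=> fD; pose P (x : S) := val x \in range D.
have fP v w : (forall x, P x -> v x = w x) -> f v = f w.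
  by move=> vw; apply: depends_sub fD _ _ vw; exact: sub_range.
have sub v w : (forall x, P x -> v x = w x) ->
    feasible (@sadj d S) (region D) v -> feasible (@sadj d S) (region D) w.
  move=> vw fv x Dx wx; have x1 : val x \in reach (@near0 d) D 1.
    case: Dx => [xD|[i iD xi]]; first exact: reachS.
    have i0 : i \in reach (@near0 d) D 0 by [].
    by apply: (reach_adj i0); move: xi => /adj_dist; rewrite distC => /adj_dist.
  have [|y yx vy] := fv x Dx; first by rewrite vw// /P mem_range reachS.
  exists y => //; rewrite -vw// /P mem_range; apply: (reach_adj x1).
  exact: (sadj_sym yx).
have FP v w : (forall x, P x -> v x = w x) ->
    feas R (@sadj d S) (region D) v = feas R (@sadj d S) (region D) w.
  move=> vw; rewrite /feas; congr (nat_of_bool _)%:R; apply: asbool_equiv_eq.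
  by split; apply: sub => // x Px; rewrite vw.
move=> v w vw; rewrite /gibbs_avg; congr (_ / _); apply: (@avg_depends _ _ _ _ _ P) vw => //.
by move=> a c ac; rewrite (FP a c)// (fP a c).
Qed.

Lemma measurable_cylinder D (eta : local_config S D) :
  measurable (cylinder eta : set (config_space S)).
Proof.
have -> : cylinder eta =
    \bigcap_(k in [set: inside S D]) [set w : config_space S | w (emb k) = eta k].
  apply/seteqP; split=> [w h k _|w h x k xk]; first by apply: h; rewrite SubK.
  have -> : x = emb k by apply: val_inj; rewrite SubK.
  exact: h.
apply: fin_bigcap_measurable => [|k _]; first exact: finite_finset.
by apply: sub_sigma_algebra; exists (emb k), (eta k).
Qed.

Lemma measurable_local A : local_event A -> measurable (A : set (config_space S)).
Proof.
move=> [D AD].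
have -> : A = \bigcup_(eta in [set eta : local_config S D | A (concat eta (fun=> false))])
    cylinder eta.
  apply/seteqP; split=> [v Av|v [eta /= Ae /cylinder_restrict ve]].
    exists (restrict D v); last exact/cylinder_restrict.
    by rewrite /=; apply: AD Av => x xD; rewrite concat_restrict.
  by apply: AD Ae => x xD; rewrite -ve concat_restrict.
apply: fin_bigcup_measurable => [|eta _]; first exact: finite_finset.
exact: measurable_cylinder.
Qed.

Lemma indic_fun (A : set (S -> bool)) : indic R A = \1_A.
Proof. by apply: funext => v; rewrite indicE. Qed.

Section Expectation.
Variable mu : probability (config_space S) R.

Definition mass (A : set (config_space S)) : R := fine (mu A).

Lemma massE A : measurable A -> mu A = (mass A)%:E.
Proof. by move=> mA; rewrite fineK// fin_num_measure. Qed.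

Definition expect D f : R :=
  \sum_(eta : local_config S D) f (concat eta (fun=> false)) * mass (cylinder eta).

(** A local observable is a finite combination of indicators of cylinders, so
    that all integrals below are finite sums of real numbers. *)
Lemma integral_local D f : depends D f -> (forall v, 0 <= f v) ->
  (\int[mu]_w (f w)%:E = (expect D f)%:E)%E.
Proof.
move=> fD f0.
have -> : (fun w : config_space S => (f w)%:E) = (fun w =>
    \sum_(eta : local_config S D)
      (f (concat eta (fun=> false)))%:E * (\1_(cylinder eta) w)%:E)%E.
  apply: funext => w; rewrite (local_expansion w fD) -sumEFin.
  by apply: eq_bigr => eta _; rewrite EFinM indic_fun.
rewrite ge0_integral_sum//.
- rewrite /expect -sumEFin; apply: eq_bigr => eta _.
  rewrite ge0_integralZl_EFin// ?integral_indic// ?setIT.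
  + by rewrite EFinM -massE//; exact: measurable_cylinder.
  + exact: measurable_cylinder.
  + by apply/measurable_EFinP; apply: measurable_indic; exact: measurable_cylinder.
- move=> eta; apply: measurable_funeM; apply/measurable_EFinP.
  by apply: measurable_indic; exact: measurable_cylinder.
- by move=> eta w _; rewrite mule_ge0// lee_fin.
Qed.

End Expectation.
End Local.

Arguments local_event {d} S.

Section Uniqueness.
Variables (R : realType) (d : nat) (p : R) (S : set (site d)).
Implicit Types (D : {fset site d}) (v w : S -> bool) (A : set (S -> bool)).
Implicit Types (mu nu : probability (config_space S) R).

Lemma indic01 A v : 0 <= indic R A v <= 1.
Proof. by rewrite /indic; case: asboolP; rewrite ?ler01 ?lexx. Qed.

Lemma mass_expect mu D A : depends D (indic R A) -> mass mu A = expect mu D (indic R A).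
Proof.
move=> AD; have mA : measurable (A : set (config_space S)).
  apply: measurable_local; by apply: (proj2 (@local_eventE R _ _ _)); exists D.
apply: EFin_inj; rewrite -(massE mu mA).
rewrite -(integral_local mu AD (fun v => proj1 (andP (indic01 A v)))).
by rewrite indic_fun integral_indic// setIT.
Qed.

Lemma mass_setT mu : mass mu setT = 1.
Proof. by rewrite /mass probability_setT. Qed.

Lemma gibbs_cylinder mu D (eta : local_config S D) : is_gibbs p mu ->
  0 < p < 1 ->
  mass mu (cylinder eta) = expect mu (range D) (gibbs_avg p D (indic R (cylinder eta))).
Proof.
move=> Hmu p01; have := Hmu D eta; rewrite (massE mu (measurable_cylinder eta)).
under eq_integral do rewrite kernelE.
rewrite (@integral_local _ _ _ mu (range D)); first by move=> [->].
- exact/depends_gibbs_avg/depends_cylinder.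
- by move=> v; apply: gibbs_avg_ge0 => // u; case/andP: (indic01 (cylinder eta) u).
Qed.

(** The DLR equations, stated for cylinders, extend to local events by
    linearity in finite sums. *)
Lemma gibbs_event mu D A : 0 < p < 1 -> is_gibbs p mu -> depends D (indic R A) ->
  mass mu A = expect mu (range D) (gibbs_avg p D (indic R A)).
Proof.
move=> p01 Hmu AD; rewrite (mass_expect mu AD) /expect.
under eq_bigr => eta _ do rewrite (gibbs_cylinder eta Hmu p01) /expect mulr_sumr.
rewrite exchange_big; apply: eq_bigr => zeta _ /=.
under eq_bigr do rewrite mulrA -gibbs_avgZ.
rewrite -mulr_suml -gibbs_avg_sum; congr (gibbs_avg _ _ _ _ * _).
by apply: funext => v; rewrite -local_expansion.
Qed.

Lemma indic_setT : indic R [set: S -> bool] = fun=> 1.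
Proof. by rewrite indic_fun indicT. Qed.

Hypothesis d2 : (2 <= d)%N.
Hypothesis hp : p_c R d < p.
Hypothesis hp1 : p < 1.

Let p01 : 0 < p < 1.
Proof. by have [-> _] := above_threshold d2 hp. Qed.

(** The DLR equation turns boundary_influence into an estimate for mu; the
    average of the constant 1 has expectation 1 by the DLR equation for the
    sure event. *)
Lemma gibbs_near mu D A (e : R) : is_gibbs p mu -> depends D (indic R A) -> 0 < e ->
  exists m, forall n, (m <= n)%N -> `|mass mu A - free_avg p n (indic R A)| <= e.
Proof.
move=> Hmu AD e0.
have [D0 h] := boundary_influence d2 hp hp1 AD (indic01 A) e0.
have [m D0m] := box_exhausts (D0 `|` D)%fset; exists m => n mn.
have {}D0m := fsubset_trans D0m (box_mono mn).
have [D0n Dn] : (D0 `<=` box n)%fset /\ (D `<=` box n)%fset.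
  by apply/andP; rewrite -fsubUset.
have {D0n}h := h _ D0n.
have En := gibbs_event p01 Hmu (depends_sub Dn AD).
have E1 : 1 = expect mu (range (box n)) (gibbs_avg p (box n) (fun=> 1)).
  by rewrite -indic_setT -gibbs_event// mass_setT.
have F1 : 1 = expect mu (range (box n)) (fun=> 1).
  by rewrite -indic_setT -mass_expect// mass_setT.
rewrite En -[free_avg _ _ _]mulr1 -[leRHS]mulr1 [X in _ - _ * X]E1 [X in _ <= _ * X]F1.
rewrite /expect !mulr_sumr -sumrB.
apply: le_trans (ler_norm_sum _ _ _) _; apply: ler_sum => zeta _.
rewrite mulrA -mulrBl normrM (ger0_norm (fine_ge0 (measure_ge0 mu _))).
by rewrite mul1r ler_wpM2r// fine_ge0.
Qed.

Lemma local_event_setI : setI_closed (local_event S).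
Proof.
move=> A B [D AD] [D' BD']; exists (D `|` D')%fset => v w vw [Av Bv]; split.
  by apply: AD Av => x xD; apply: vw; rewrite inE xD.
by apply: BD' Bv => x xD; apply: vw; rewrite inE xD orbT.
Qed.

Lemma local_event_setT : local_event S setT.
Proof. by exists fset0. Qed.

Lemma sigma_local : <<s local_event S >> = <<s coordinate_events S >>.
Proof.
apply/seteqP; split; apply: smallest_sub.
- exact: smallest_sigma_algebra.
- by move=> A; exact: measurable_local.
- exact: smallest_sigma_algebra.
- move=> _ [i [b ->]]; apply: sub_sigma_algebra; exists [fset val i]%fset => v w vw /= <-.
  by rewrite vw// inE.
Qed.

Lemma gibbs_unique mu nu A : is_gibbs p mu -> is_gibbs p nu ->
  measurable (A : set (config_space S)) -> nu A = mu A.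
Proof.
move=> Hmu Hnu mA.
apply: (@measure_unique _ R (config_space S) (local_event S) (fun=> setT)
  _ _ _ _ nu mu) => //.
- by rewrite sigma_local.
- exact: local_event_setI.
- by move=> _; exact: local_event_setT.
- by apply/seteqP; split=> // v _; exists 0%N.
- move=> B LB; have mB := measurable_local LB.
  move: LB => /(@local_eventE R)[D BD].
  transitivity (mass nu B)%:E; first exact: massE.
  transitivity (mass mu B)%:E; last exact/esym/massE.
  congr EFin; apply/eqP.
  rewrite -subr_eq0 -normr_le0; apply/ler_addgt0Pl => e e0.
  have e20 : 0 < e / 2 by rewrite divr_gt0.
  have [m1 h1] := gibbs_near Hmu BD e20; have [m2 h2] := gibbs_near Hnu BD e20.
  have := h1 (maxn m1 m2) (leq_maxl _ _); have := h2 (maxn m1 m2) (leq_maxr _ _).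
  rewrite addr0; set a := free_avg _ _ _ => k2 k1.
  rewrite (_ : _ - _ = (mass nu B - a) - (mass mu B - a)); last by ring.
  by apply: le_trans (ler_normB _ _) _; rewrite [leRHS]splitr lerD.
- by move=> _; rewrite -ge0_fin_numE//; exact: fin_num_measure.
Qed.

End Uniqueness.

(** * Existence *)

Section LocalAlgebra.
Variables (d : nat) (S : set (site d)).

Lemma local_event_setD : setD_closed (local_event S).
Proof.
move=> A B [D AD] [D' BD']; exists (D `|` D')%fset => v w vw [Av Bv]; split.
  by apply: AD Av => x xD; apply: vw; rewrite inE xD.
by move=> Bw; apply: Bv; apply: BD' Bw => x xD; rewrite vw// inE xD orbT.
Qed.

(** The configurations, with the algebra of local events in place of the
    sigma-algebra that it generates. *)
Definition local_space : Type := config S.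
HB.instance Definition _ := Pointed.on local_space.
HB.instance Definition _ := isAlgebraOfSets_setD.Build default_measure_display
  local_space (@local_event_setT d S) local_event_setD.

Definition product_space := prod_topology (fun _ : S => bool).
HB.instance Definition _ := Pointed.copy product_space (config S).
HB.instance Definition _ := Topological.copy product_space (prod_topology (fun _ : S => bool)).

Lemma open_local A : local_event S A -> open (A : set product_space).
Proof.
move=> [D AD]; rewrite openE => v Av.
have near_v (s : seq S) : nbhs (v : product_space)
    [set w : product_space | forall x, x \in s -> v x = w x].
  elim: s => [|x s IH]; first by apply: filterS filterT => w _ x.
  have : nbhs (v : product_space)
      [set w : product_space | v x = w x].
    have := @proj_continuous S (fun=> bool) x v.
    by move=> /(_ [set b | v x = b]); apply; apply: open_nbhs_nbhs; split=> //; exact: discrete_open.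
  apply: filterS2 IH => w vw xw y; rewrite inE => /orP[/eqP ->//|].
  exact: vw.
apply: filterS (near_v (sites S D)) => w vw; apply: AD Av => x xD.
by apply: vw; rewrite mem_sites.
Qed.

(** The product space is compact and local events are both open and closed. *)
Lemma local_compact (A : set (S -> bool)) (F : nat -> set (S -> bool)) :
  local_event S A -> (forall n, local_event S (F n)) -> A `<=` \bigcup_n F n ->
  exists N, A `<=` \big[setU/set0]_(k < N) F k.
Proof.
move=> LA LF AF.
have cT : compact [set: product_space].
  have := @tychonoff _ (fun _ : S => _) _ (fun=> bool_compact).
  by congr (compact _); rewrite eqEsubset.
move: cT; rewrite compact_cover => /(_ nat setT (fun n => F n `|` ~` A)) [].
- move=> n _; apply: openU; first exact: open_local.
  apply: open_local; rewrite -setTD; apply: local_event_setD => //.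
  exact: local_event_setT.
- move=> v _; have [Av|nAv] := pselect (A v); last by exists 0%N => //; right.
  by have [n _ Fv] := AF v Av; exists n => //; left.
move=> D' _ cov; exists (\max_(n <- D') n).+1 => v Av.
have [n /= nD [Fv|//]] := cov v I.
rewrite -bigcup_mkord; exists n => //=; rewrite ltnS.
exact: (leq_bigmax_seq n nD isT).
Qed.

End LocalAlgebra.

Section Existence.
Variables (R : realType) (d : nat) (p : R) (S : set (site d)).
Hypothesis d2 : (2 <= d)%N.
Hypothesis hp : p_c R d < p.
Hypothesis hp1 : p < 1.
Implicit Types (A : set (S -> bool)) (D : {fset site d}).

Let p01 : 0 < p < 1.
Proof. by have [-> _] := above_threshold d2 hp. Qed.

Definition prob A : R := state p (indic R A).

Lemma cvg_prob A : local_event S A -> free_avg p n (indic R A) @[n --> \oo] --> prob A.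
Proof. by move=> /(@local_eventE R)[D AD]; exact: (cvg_state d2 hp hp1 AD (indic01 R A)). Qed.

Lemma prob_ge0 A : local_event S A -> 0 <= prob A.
Proof.
move=> LA; apply: limr_ge; first exact: (cvgP _ (cvg_prob LA)).
apply: nearW => n.
by apply: gibbs_avg_ge0 => // v; case/andP: (indic01 R A v).
Qed.

Lemma prob_sum (I : Type) (r : seq I) (c : I -> R) (F : I -> set (S -> bool)) :
  (forall i, local_event S (F i)) ->
  free_avg p n (fun v => \sum_(i <- r) c i * indic R (F i) v) @[n --> \oo] -->
  \sum_(i <- r) c i * prob (F i).
Proof.
move=> LF; have -> : (fun n => free_avg p n (fun v => \sum_(i <- r) c i * indic R (F i) v)) =
    (fun n => \sum_(i <- r) c i * free_avg p n (indic R (F i))).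
  apply: funext => n; rewrite /free_avg gibbs_avg_sum.
  by apply: eq_bigr => i _; rewrite gibbs_avgZ.
apply: cvg_big => [|i _]; first exact: add_continuous.
by apply: cvgM; [exact: cvg_cst|exact: cvg_prob].
Qed.

Lemma prob_setT : prob setT = 1.
Proof.
apply/cvg_lim => //; rewrite (_ : (fun n => _) = cst 1); first exact: cvg_cst.
by apply: funext => n; rewrite /free_avg indic_setT gibbs_avg1.
Qed.

Definition premeasure (A : set (local_space S)) : \bar R :=
  if `[< local_event S A >] then (prob A)%:E else 0%E.

Lemma premeasureE A : local_event S A -> premeasure A = (prob A)%:E.
Proof. by move=> LA; rewrite /premeasure asboolT. Qed.

Lemma premeasure_ge0 A : (0 <= premeasure A)%E.
Proof. by rewrite /premeasure; case: asboolP => // LA; rewrite lee_fin prob_ge0. Qed.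

Lemma premeasure_additive : measure_function.semi_additive premeasure.
Proof.
move=> F n mF tF mU; rewrite premeasureE//.
rewrite (eq_bigr (fun i : 'I_n => (prob (F i))%:E)); last first.
  by move=> i _; apply: premeasureE; exact: mF.
rewrite sumEFin; congr EFin.
have := @prob_sum nat (index_iota 0 n) (fun=> 1) F mF.
under eq_bigr do rewrite mul1r.
rewrite big_mkord; apply: cvg_unique => //.
rewrite (_ : (fun v => _) = indic R (\big[setU/set0]_(i < n) F i)); first exact: cvg_prob.
apply: funext => v; rewrite big_mkord.
under eq_bigr do rewrite mul1r.
have [[i Fiv]|none] := pselect (exists i : 'I_n, F i v).
  rewrite (bigD1 i)//= big1 => [|j ji]; last first.
    rewrite /indic; case: asboolP => // Fjv; case/eqP: ji; apply: val_inj.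
    by apply: tF => //; exists v.
  rewrite addr0 /indic !asboolT// -bigcup_mkord; exists i => //=.
rewrite big1 => [|j _]; last first.
  by rewrite /indic; case: asboolP => // Fjv; case: none; exists j.
rewrite /indic asboolF// -bigcup_mkord => -[j /= jn Fjv]; apply: none.
by exists (Ordinal jn).
Qed.

HB.instance Definition _ := isContent.Build default_measure_display
  (local_space S) R premeasure premeasure_ge0 premeasure_additive.

Lemma premeasure_sigma_subadditive : measurable_subset_sigma_subadditive premeasure.
Proof.
move=> A F mF mA AF; have [N AN] := local_compact mA mF AF.
apply: le_trans (nneseries_lim_ge N (fun n _ _ => premeasure_ge0 (F n))).
rewrite big_mkord.
by apply: content_subadditive => // k _; exact: mF.
Qed.

HB.instance Definition _ := Content_SigmaSubAdditive_isMeasure.Build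
  default_measure_display R (local_space S) premeasure premeasure_sigma_subadditive.

Definition extended_measure (A : set (config_space S)) : \bar R :=
  measure_extension premeasure A.

Lemma measurable_localE A : measurable (A : set (config_space S)) ->
  measurable (A : set (g_sigma_algebraType (@measurable _ (local_space S)))).
Proof. by rewrite /measurable /= -sigma_local. Qed.

Lemma extended_measure0 : extended_measure set0 = 0%E.
Proof. exact: measure0. Qed.

Lemma extended_measure_ge0 A : (0 <= extended_measure A)%E.
Proof. exact: measure_ge0. Qed.

Lemma extended_measure_sigma_additive : semi_sigma_additive extended_measure.
Proof.
move=> F mF tF mU; apply: measure_semi_sigma_additive => //.
  by move=> n; exact: measurable_localE.
exact: measurable_localE.
Qed.

HB.instance Definition _ := isMeasure.Build _ (config_space S) R extended_measure
  extended_measure0 extended_measure_ge0 extended_measure_sigma_additive.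

Lemma extended_measure_local A : local_event S A -> extended_measure A = (prob A)%:E.
Proof.
move=> LA; rewrite /extended_measure /measure_extension measurable_mu_extE//.
exact: premeasureE.
Qed.

Lemma extended_measure_setT : extended_measure setT = 1%E.
Proof. by rewrite extended_measure_local ?prob_setT//; exact: local_event_setT. Qed.

HB.instance Definition _ := Measure_isProbability.Build _ _ R extended_measure
  extended_measure_setT.

(** The kernel is a local observable, so the DLR equation passes to the limit
    from the consistency of the finite-volume averages. *)
Lemma extended_measure_gibbs : is_gibbs p extended_measure.
Proof.
have loc D (eta : local_config S D) : local_event S (cylinder eta).
  by apply/(@local_eventE R); exists D; exact: depends_cylinder.
move=> D eta; rewrite [RHS](extended_measure_local (loc D eta)).
under eq_integral do rewrite kernelE.
have dep := depends_gibbs_avg p (depends_cylinder R eta).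
rewrite (@integral_local _ _ _ _ (range D)); last 2 first.
- exact: dep.
- by move=> v; apply: gibbs_avg_ge0 => // u; case/andP: (indic01 R (cylinder eta) u).
congr EFin; rewrite /expect.
rewrite (eq_bigr (fun zeta : local_config S (range D) =>
  gibbs_avg p D (indic R (cylinder eta)) (concat zeta (fun=> false)) *
  prob (cylinder zeta))); last first.
  move=> zeta _; congr (_ * _).
  exact: (congr1 fine (extended_measure_local (loc _ zeta))).
have cv := @prob_sum _ (index_enum _) (fun zeta : local_config S (range D) =>
  gibbs_avg p D (indic R (cylinder eta)) (concat zeta (fun=> false)))
  (fun zeta => cylinder zeta) (fun zeta => loc _ zeta).
apply: (cvg_unique _ cv) => //.
have [m Dm] := box_exhausts D.
apply: cvg_trans (cvg_prob (loc _ eta)); apply: near_eq_cvg; exists m => // n /= mn.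
rewrite /free_avg -(gibbs_avg_consistent p01 _ (fsubset_trans Dm (box_mono mn)) (indic01 R _)).
by congr gibbs_avg; apply: funext => v; rewrite -local_expansion.
Qed.

Lemma gibbs_exists : exists mu : probability (config_space S) R, is_gibbs p mu.
Proof. by exists extended_measure; exact: extended_measure_gibbs. Qed.

End Existence.

Theorem proposition4p1 (R : realType) (d : nat) (hd : (2 <= d)%N)
    (p : R) (hp : p_c R d < p) (hp1 : p < 1) (S : set (site d)) :
  unique_gibbs p S.
Proof.
have [mu Hmu] := gibbs_exists S hd hp hp1.
by exists mu => // nu Hnu A mA; exact: (gibbs_unique hd hp hp1 Hmu Hnu mA).
Qed.
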